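(* Let $\mathcal{H}$ be a Hopf algebra, let $M$ be a right-left module-comodule over $\mathcal{H}$, and let $C$ be a right $\mathcal{H}$-comodule coalgebra. If $M$ is an $\mathcal{H}^C$-SAYD module, then $M$ is an $\mathcal{H}^C$-HCC module.
   Context: All Hopf algebras are over a ground field $k$ and have bijective antipode $S$. Coproducts: $\Delta(h)=h^{(1)}\otimes h^{(2)}$. Left coactions are written $x\mapsto x_{<-1>}\otimes x_{<0>}$, right coactions $x\mapsto x_{<0>}\otimes x_{<1>}$. A right-left module-comodule over $\mathcal{H}$ is a vector space $M$ with a right $\mathcal{H}$-action and a left $\mathcal{H}$-coaction (no compatibility is assumed). A right $\mathcal{H}$-comodule coalgebra is a coalgebra $C$ with a right $\mathcal{H}$-coaction such that $c_{<0>}^{(1)}\otimes c_{<0>}^{(2)}\otimes c_{<1>}=(c^{(1)})_{<0>}\otimes (c^{(2)})_{<0>}\otimes (c^{(1)})_{<1>}(c^{(2)})_{<1>}$ and $\varepsilon(c_{<0>})c_{<1>}=\varepsilon(c)1$. $\mathcal{H}$ coacts on $C^{\otimes(n+1)}$ diagonally from the right: $c_0\otimes\cdots\otimes c_n\mapsto (c_0)_{<0>}\otimes\cdots\otimes (c_n)_{<0>}\otimes (c_0)_{<1>}\cdots (c_n)_{<1>}$, written $\widetilde d\mapsto\widetilde d_{<0>}\otimes\widetilde d_{<1>}$. The cotensor product $C^{\otimes(n+1)}\square_{\mathcal{H}}M$ is the subspace of (sums of) elements $\widetilde d\otimes m$ of $C^{\otimes (n+1)}\otimes M$ with $\widetilde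 d_{<0>}\otimes\widetilde d_{<1>}\otimes m=\widetilde d\otimes m_{<-1>}\otimes m_{<0>}$ (summation suppressed). Definition ($\mathcal{H}^C$-SAYD). $M$ is an $\mathcal{H}^C$-SAYD module if (i) $c_{<0>}\otimes(mc_{<1>})_{<-1>}\otimes(mc_{<1>})_{<0>}=c_{<0>}\otimes S(c_{<1>}^{(3)})\,m_{<-1>}\,c_{<1>}^{(1)}\otimes m_{<0>}c_{<1>}^{(2)}$ for all $c\in C$, $m\in M$; (ii) $\widetilde d_{<0>}\otimes m\widetilde d_{<1>}=\widetilde d\otimes m$ for every element $\widetilde d\otimes m$ (summation suppressed) of $C^{\otimes(n+1)}\square_{\mathcal{H}}M$, for all $n\ge0$. Definition ($\mathcal{H}^C$-HCC, Hopf cyclic coefficients). $M$ is an $\mathcal{H}^C$-HCC module if the following operators are well defined on the spaces $C^n=C^{\otimes(n+1)}\square_{\mathcal{H}}M$, $n\ge0$ (i.e. preserve the cotensor products), and make $\{C^n\}_{n\ge0}$ a cocyclic module: cofaces $\delta_i:C^{n-1}\to C^n$, $\delta_i(c_0\otimes\cdots\otimes c_{n-1}\otimes m)=c_0\otimes\cdots\otimes\Delta(c_i)\otimes\cdots\otimes c_{n-1}\otimes m$ for $0\le i<n$, and $\delta_n(c_0\otimes\cdots\otimes c_{n-1}\otimes m)=c_0^{(2)}\otimes c_1\otimes\cdots\otimes c_{n-1}\otimes (c_0^{(1)})_{<0>}\otimes m\,(c_0^{(1)})_{<1>}$; codegeneracies $\sigma_i:C^{n+1}\to C^n$, $\sigma_i(c_0\otimes\cdots\otimes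 c_{n+1}\otimes m)=c_0\otimes\cdots\otimes c_i\otimes\varepsilon(c_{i+1})\otimes c_{i+2}\otimes\cdots\otimes c_{n+1}\otimes m$ for $0\le i\le n$ (the scalar $\varepsilon(c_{i+1})$ being absorbed); cyclic operator $\tau_n:C^n\to C^n$, $\tau_n(c_0\otimes\cdots\otimes c_n\otimes m)=c_1\otimes\cdots\otimes c_n\otimes (c_0)_{<0>}\otimes m\,(c_0)_{<1>}$. *)

(* Defs.v *)
From HB Require Import structures.
From mathcomp Require Import all_boot all_algebra.
From mathcomp Require Import boolp.

Set Implicit Arguments.
Unset Strict Implicit.
Unset Printing Implicit Defensive.

Import GRing.Theory.
Local Open Scope quotient_scope.
Local Open Scope ring_scope.

Declare Scope tens_scope.
Delimit Scope tens_scope with T.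

(* A formal sum of elementary tensors is a sequence of pairs.  Two formal sums
   are identified when no bilinear map into any vector space separates them;
   by the universal property this is the congruence generated by the
   bilinearity relations. *)
Section TensorProduct.
Context {k : fieldType} (V W : lmodType k).

Definition fsum (U : zmodType) (f : V -> W -> U) (s : seq (V * W)) : U :=
  \sum_(p <- s) f p.1 p.2.

Definition fsum_eq (s t : seq (V * W)) : bool :=
  `[< forall (U : lmodType k) (f : V -> W -> U),
        bilinear_for *:%R *:%R f -> fsum f s = fsum f t >].

Lemma fsum_eq_refl : reflexive fsum_eq.
Proof. by move=> s; apply/asboolP. Qed.

Lemma fsum_eq_sym : symmetric fsum_eq.
Proof.
by move=> s t; apply/asboolP/asboolP => h U f bf; rewrite h.
Qed.

Lemma fsum_eq_trans : transitive fsum_eq.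
Proof.
by move=> t s u /asboolP h1 /asboolP h2; apply/asboolP => U f bf;
  rewrite h1 ?h2.
Qed.

Canonical fsum_equiv := EquivRel fsum_eq fsum_eq_refl fsum_eq_sym fsum_eq_trans.

Definition tensor : Type := {eq_quot fsum_equiv}.
HB.instance Definition _ := Choice.on tensor.
HB.instance Definition _ := Quotient.on tensor.

Definition tpi (s : seq (V * W)) : tensor := (\pi_tensor s)%qT.

(* The linear map on the tensor product induced by a bilinear map [f]; it is
   only meaningful for bilinear [f], see [tliftE]. *)
Definition tlift (U : zmodType) (f : V -> W -> U) (t : tensor) : U :=
  fsum f (repr t).

Lemma tpiP s t :
  (forall (U : lmodType k) (f : V -> W -> U),
        bilinear_for *:%R *:%R f -> fsum f s = fsum f t) -> tpi s = tpi t.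
Proof. by move=> h; apply/eqmodP/asboolP. Qed.

Lemma tlift_pi (U : lmodType k) (f : V -> W -> U) s :
  bilinear_for *:%R *:%R f -> tlift f (tpi s) = fsum f s.
Proof.
move=> bf; rewrite /tlift; have /eqmodP/asboolP -> // : repr (tpi s) = s %[mod_eq fsum_equiv].
by rewrite reprK.
Qed.

Lemma tpi_repr t : tpi (repr t) = t. Proof. exact: reprK. Qed.

Lemma tensor_eqP (t u : tensor) :
  (forall (U : lmodType k) (f : V -> W -> U),
      bilinear_for *:%R *:%R f -> tlift f t = tlift f u) -> t = u.
Proof.
by move=> h; rewrite -(tpi_repr t) -(tpi_repr u); apply: tpiP => U f bf;
  exact: h.
Qed.

Definition tzero := tpi [::].
Definition tadd (t u : tensor) := tpi (repr t ++ repr u).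
Definition tscale (a : k) (t : tensor) := tpi [seq (a *: p.1, p.2) | p <- repr t].
Definition topp (t : tensor) := tscale (-1) t.

Section lift_operations.
Variables (U : lmodType k) (f : V -> W -> U).
Hypothesis bf : bilinear_for *:%R *:%R f.

Lemma tlift_zero : tlift f tzero = 0.
Proof. by rewrite tlift_pi // /fsum big_nil. Qed.

Lemma tlift_add t u : tlift f (tadd t u) = tlift f t + tlift f u.
Proof. by rewrite tlift_pi // /fsum big_cat. Qed.

Lemma tlift_scale a t : tlift f (tscale a t) = a *: tlift f t.
Proof.
rewrite tlift_pi // /tlift /fsum big_map scaler_sumr.
apply: eq_bigr => p _ /=; have := bf.1 p.2 a p.1 0; rewrite addr0 /= => ->.
suff -> : f 0 p.2 = 0 by rewrite addr0.
by have := bf.1 p.2 (-1) 0 0; rewrite /= scaler0 addr0 scaleN1r addNr.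
Qed.

Lemma tlift_opp t : tlift f (topp t) = - tlift f t.
Proof. by rewrite tlift_scale scaleN1r. Qed.
End lift_operations.

Let tE := (tlift_zero, tlift_add, tlift_scale, tlift_opp).

Fact taddA : associative tadd.
Proof. by move=> t u v; apply: tensor_eqP => U f bf; rewrite !tE // addrA. Qed.
Fact taddC : commutative tadd.
Proof. by move=> t u; apply: tensor_eqP => U f bf; rewrite !tE // addrC. Qed.
Fact tadd0 : left_id tzero tadd.
Proof. by move=> t; apply: tensor_eqP => U f bf; rewrite !tE // add0r. Qed.
Fact taddN : left_inverse tzero topp tadd.
Proof. by move=> t; apply: tensor_eqP => U f bf; rewrite !tE // addNr. Qed.

HB.instance Definition _ :=
  GRing.isZmodule.Build tensor taddA taddC tadd0 taddN.

Fact tscaleA a b t : tscale a (tscale b t) = tscale (a * b) t.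
Proof. by apply: tensor_eqP => U f bf; rewrite !tE // scalerA. Qed.
Fact tscale1 : left_id 1 tscale.
Proof. by move=> t; apply: tensor_eqP => U f bf; rewrite !tE // scale1r. Qed.
Fact tscaleDr : right_distributive tscale +%R.
Proof.
move=> a t u; apply: tensor_eqP => U f bf.
by rewrite [LHS]tlift_scale // [tlift f (t + u)]tlift_add // [RHS]tlift_add //
  !tlift_scale // scalerDr.
Qed.
Fact tscaleDl t : {morph tscale^~ t : a b / a + b}.
Proof.
move=> a b; apply: tensor_eqP => U f bf.
by rewrite [LHS]tlift_scale // [RHS]tlift_add // !tlift_scale // scalerDl.
Qed.

HB.instance Definition _ :=
  GRing.Zmodule_isLmodule.Build k tensor tscaleA tscale1 tscaleDr tscaleDl.

Definition tens (v : V) (w : W) : tensor := tpi [:: (v, w)].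

Lemma tlift_linear (U : lmodType k) (f : V -> W -> U) :
  bilinear_for *:%R *:%R f -> linear (tlift f).
Proof.
by move=> bf a t u; rewrite -(tlift_scale bf) -(tlift_add bf).
Qed.

Lemma tliftE (U : lmodType k) (f : V -> W -> U) v w :
  bilinear_for *:%R *:%R f -> tlift f (tens v w) = f v w.
Proof. by move=> bf; rewrite tlift_pi // /fsum big_seq1. Qed.

Lemma tens_bilinear : bilinear_for *:%R *:%R tens.
Proof.
split=> [w|v] a x y; apply: tensor_eqP => U f bf.
  by rewrite (tlift_linear bf) !tliftE // bf.1.
by rewrite (tlift_linear bf) !tliftE // bf.2.
Qed.

Lemma tensE (t : tensor) : t = tlift tens t.
Proof.
apply: tensor_eqP => U f bf.
pose g : tensor -> U := tlift f.
have g0 : g 0 = 0 by exact: tlift_zero.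
have gD : {morph g : x y / x + y} by exact: tlift_add.
rewrite -[RHS]/(g _) /tlift /fsum (big_morph g gD g0).
by apply: eq_bigr => p _; rewrite /g tliftE.
Qed.

End TensorProduct.

Notation "V ⨂ W" := (tensor V W)
  (at level 40, left associativity) : type_scope.
Notation "V ⨂ W" := (tensor V W)
  (at level 40, left associativity) : tens_scope.
Notation "x ⊗ y" := (tens x y)
  (at level 40, left associativity) : tens_scope.
Local Open Scope tens_scope.

(* Sweedler notation: if t = \sum_i a_i ⊗ b_i, then \tens_( a , b <- t ) e is
   the sum over i of the values of e at a := a_i and b := b_i. *)
Notation "\tens_ ( a , b <- t ) e" := (tlift (fun a b => e) t)
  (at level 41, a name, b name, t at level 200, e at level 41,
   format "\tens_ ( a ,  b  <-  t )  e") : tens_scope.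

Section Linearity.
Context {k : fieldType}.
Implicit Types (X U V W : lmodType k).

Lemma lin_bilinear U V W (f : U -> V -> W) :
  (forall v, linear (f^~ v)) -> (forall u, linear (f u)) ->
  bilinear_for *:%R *:%R f.
Proof. by []. Qed.

Lemma lin_id V : linear (fun x : V => x). Proof. by []. Qed.

Lemma lin_app X V W (L : {linear V -> W}) (g : X -> V) :
  linear g -> linear (fun x => L (g x)).
Proof. by move=> gl a x y; rewrite gl linearP. Qed.

Lemma lin_scalel X V (c : k) (g : X -> V) :
  linear g -> linear (fun x => c *: g x).
Proof. by move=> gl a x y; rewrite gl scalerDr !scalerA mulrC. Qed.

Lemma lin_scaler X V (L : {scalar X}) (v : V) : linear (fun x => L x *: v).
Proof.
by move=> a x y; rewrite linearP /= scalerDl -scalerA.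
Qed.

Lemma lin_mull X (A : algType k) (g : X -> A) b :
  linear g -> linear (fun x => g x * b).
Proof. by move=> gl a x y; rewrite gl mulrDl scalerAl. Qed.

Lemma lin_mulr X (A : algType k) (g : X -> A) b :
  linear g -> linear (fun x => b * g x).
Proof. by move=> gl a x y; rewrite gl mulrDr scalerAr. Qed.

Lemma lin_tensl X V W (g : X -> V) (w : W) :
  linear g -> linear (fun x => g x ⊗ w).
Proof. by move=> gl a x y; rewrite gl (tens_bilinear V W).1. Qed.

Lemma lin_tensr X V W (v : V) (g : X -> W) :
  linear g -> linear (fun x => v ⊗ g x).
Proof. by move=> gl a x y; rewrite gl (tens_bilinear V W).2. Qed.

Lemma lin_lift X U V W (f : V -> W -> U) (g : X -> V ⨂ W) :
  (forall w, linear (f^~ w)) -> (forall v, linear (f v)) ->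
  linear g -> linear (fun x => tlift f (g x)).
Proof. by move=> f1 f2 gl a x y; rewrite gl tlift_linear. Qed.

Lemma lin_body X U V W (F : X -> V -> W -> U) (t : V ⨂ W) :
  (forall v w, linear (fun x => F x v w)) ->
  linear (fun x => \tens_(v, w <- t) F x v w).
Proof.
move=> Fl a x y; rewrite /tlift /fsum scaler_sumr -big_split.
by apply: eq_bigr => p _; rewrite Fl.
Qed.

End Linearity.

Ltac lin_hook := fail.
Ltac lin :=
  intros; cbv beta; first
  [ match goal with h : _ |- _ => exact: h end | exact: lin_id
  | (apply: lin_tensl; lin) | (apply: lin_tensr; lin)
  | (apply: lin_lift; lin) | (apply: lin_body; lin)
  | (apply: lin_mull; lin) | (apply: lin_mulr; lin)
  | exact: lin_scaler | (apply: lin_scalel; lin)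
  | (lin_hook; lin) | (apply: lin_app; lin) ].

Section Coalgebra.
Context {k : fieldType}.

Record coalgebra_axioms (V : lmodType k)
    (D : {linear V -> V ⨂ V}) (e : {scalar V}) : Prop := CoalgebraAxioms {
  comulA : forall c,
    \tens_(a, b <- D c) \tens_(a1, a2 <- D a) a1 ⊗ (a2 ⊗ b)
    = \tens_(a, b <- D c) a ⊗ D b;
  counitl : forall c, \tens_(a, b <- D c) e a *: b = c;
  counitr : forall c, \tens_(a, b <- D c) e b *: a = c
}.

End Coalgebra.

Record hopfAlgebra (k : fieldType) := HopfAlgebra {
  hopf_alg :> algType k;
  hcomul : {linear hopf_alg -> hopf_alg ⨂ hopf_alg};
  hcounit : {scalar hopf_alg};
  antipode : {linear hopf_alg -> hopf_alg};
  hopf_coalgebra : coalgebra_axioms hcomul hcounit;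
  hcomulM : forall g h, hcomul (g * h) =
    \tens_(g1, g2 <- hcomul g) \tens_(h1, h2 <- hcomul h)
      (g1 * h1) ⊗ (g2 * h2);
  hcomul1 : hcomul 1 = 1 ⊗ 1;
  hcounitM : forall g h, hcounit (g * h) = hcounit g * hcounit h;
  hcounit1 : hcounit 1 = 1;
  antipodel : forall h,
    \tens_(h1, h2 <- hcomul h) (antipode h1 * h2) = hcounit h *: 1;
  antipoder : forall h,
    \tens_(h1, h2 <- hcomul h) (h1 * antipode h2) = hcounit h *: 1;
  antipode_bij : bijective antipode
}.

Section Comodules.
Context {k : fieldType} (H : hopfAlgebra k).

Record left_coaction_axioms (M : lmodType k) (l : {linear M -> H ⨂ M}) :
    Prop := LeftCoactionAxioms {
  lcoactA : forall m,
    \tens_(h, m0 <- l m) \tens_(h1, h2 <- hcomul H h) h1 ⊗ (h2 ⊗ m0)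
    = \tens_(h, m0 <- l m) h ⊗ l m0;
  lcoact1 : forall m, \tens_(h, m0 <- l m) hcounit H h *: m0 = m
}.

Record right_coaction_axioms (V : lmodType k) (r : {linear V -> V ⨂ H}) :
    Prop := RightCoactionAxioms {
  rcoactA : forall v,
    \tens_(v0, h <- r v) r v0 ⊗ h
    = \tens_(v0, h <- r v) \tens_(h1, h2 <- hcomul H h) (v0 ⊗ h1) ⊗ h2;
  rcoact1 : forall v, \tens_(v0, h <- r v) hcounit H h *: v0 = v
}.

Record modcomod := Modcomod {
  mc_sort :> lmodType k;
  act : mc_sort -> H -> mc_sort;
  lcoact : {linear mc_sort -> H ⨂ mc_sort};
  act_bilinear : bilinear_for *:%R *:%R act;
  act1 : forall m, act m 1 = m;
  actM : forall m g h, act m (g * h) = act (act m g) h;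
  lcoact_axioms : left_coaction_axioms lcoact
}.

Record comodCoalgebra := ComodCoalgebra {
  cc_sort :> lmodType k;
  comul : {linear cc_sort -> cc_sort ⨂ cc_sort};
  counit : {scalar cc_sort};
  rcoact : {linear cc_sort -> cc_sort ⨂ H};
  cc_coalgebra : coalgebra_axioms comul counit;
  rcoact_axioms : right_coaction_axioms rcoact;
  rcoact_comul : forall c,
    \tens_(c0, c1 <- rcoact c) comul c0 ⊗ c1
    = \tens_(a, b <- comul c)
        \tens_(a0, a1 <- rcoact a) \tens_(b0, b1 <- rcoact b)
          (a0 ⊗ b0) ⊗ (a1 * b1);
  rcoact_counit : forall c,
    \tens_(c0, c1 <- rcoact c) counit c0 *: c1 = counit c *: 1
}.

Lemma lin_actl (X : lmodType k) (M : modcomod) (g : X -> M) h :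
  linear g -> linear (fun x => act (g x) h).
Proof. by move=> gl a x y; rewrite gl (act_bilinear M).1. Qed.

Lemma lin_actr (X : lmodType k) (M : modcomod) m (g : X -> H) :
  linear g -> linear (fun x => act (m : M) (g x)).
Proof. by move=> gl a x y; rewrite gl (act_bilinear M).2. Qed.

Section Cotensor.
Variables (V M : lmodType k).
Variables (r : {linear V -> V ⨂ H}) (l : {linear M -> H ⨂ M}).

Definition cotensor_pred : {pred V ⨂ M} := [pred x |
  \tens_(v, m <- x) \tens_(v0, v1 <- r v) v0 ⊗ (v1 ⊗ m)
  == \tens_(v, m <- x) v ⊗ l m].

Lemma cotensor_submod : submod_closed cotensor_pred.
Proof.
have L1 : linear (fun x : V ⨂ M =>
   \tens_(v, m <- x) \tens_(v0, v1 <- r v) v0 ⊗ (v1 ⊗ m)) by lin.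
have L2 : linear (fun x : V ⨂ M => \tens_(v, m <- x) v ⊗ l m) by lin.
split=> [|a x y]; rewrite !inE.
  have := L1 (-1) 0 0; have := L2 (-1) 0 0.
  by rewrite !scaleN1r !addNr => -> ->.
by move=> /eqP ex /eqP ey; rewrite L1 L2 ex ey.
Qed.

HB.instance Definition _ :=
  GRing.isSubmodClosed.Build k (V ⨂ M) cotensor_pred cotensor_submod.

Record cotensor : Type := Cotensor {
  cotensor_val : V ⨂ M;
  cotensorP : cotensor_val \in cotensor_pred }.

HB.instance Definition _ := [isSub for cotensor_val].
HB.instance Definition _ := [Choice of cotensor by <:].
HB.instance Definition _ := [SubChoice_isSubZmodule of cotensor by <:].
HB.instance Definition _ := [SubZmodule_isSubLmodule of cotensor by <:].

End Cotensor.

End Comodules.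

Ltac lin_hook ::= first [apply: lin_actl | apply: lin_actr].

(* The coface d n i : X n -> X n.+1 is constrained for i <= n.+1 only, and the
   codegeneracy s n i : X n.+1 -> X n for i <= n only. *)
Record cocyclic (k : fieldType) (X : nat -> lmodType k)
    (d : forall n, nat -> {linear X n -> X n.+1})
    (s : forall n, nat -> {linear X n.+1 -> X n})
    (t : forall n, {linear X n -> X n}) : Prop := Cocyclic {
  coface_coface : forall n i j (x : X n), (i <= j <= n.+1)%N ->
    d n.+1 j.+1 (d n i x) = d n.+1 i (d n j x);
  codegen_codegen : forall n i j (x : X n.+2), (i <= j <= n)%N ->
    s n j (s n.+1 i x) = s n i (s n.+1 j.+1 x);
  codegen_coface_lt : forall n i j (x : X n.+1), (i <= j <= n)%N ->
    s n.+1 j.+1 (d n.+1 i x) = d n i (s n j x);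
  codegen_coface_id : forall n j (x : X n), (j <= n)%N ->
    s n j (d n j x) = x /\ s n j (d n j.+1 x) = x;
  codegen_coface_gt : forall n i j (x : X n.+1), (j < i <= n.+1)%N ->
    s n.+1 j (d n.+1 i.+1 x) = d n i (s n j x);
  cyclic_coface0 : forall n (x : X n),
    t n.+1 (d n 0 x) = d n n.+1 x;
  cyclic_cofaceS : forall n i (x : X n), (i <= n)%N ->
    t n.+1 (d n i.+1 x) = d n i (t n x);
  cyclic_codegen0 : forall n (x : X n.+1),
    t n (s n 0 x) = s n n (t n.+1 (t n.+1 x));
  cyclic_codegenS : forall n i (x : X n.+1), (i < n)%N ->
    t n (s n i.+1 x) = s n i (t n.+1 x);
  cyclic_order : forall n (x : X n), iter n.+1 (t n) x = x
}.

Section Operators.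
Context {k : fieldType} {H : hopfAlgebra k} (C : comodCoalgebra H).

(* tpow n is the (n+1)-fold tensor power of C, nested to the right. *)
Fixpoint tpow (n : nat) : lmodType k :=
  match n with
  | 0 => C
  | n'.+1 => C ⨂ tpow n'
  end.

(* c_0 ⊗ ... ⊗ c_n |-> (c_0)_0 ⊗ ... ⊗ (c_n)_0 ⊗ (c_0)_1 ... (c_n)_1 *)
Fixpoint diag_coact (n : nat) : tpow n -> tpow n ⨂ H :=
  match n return tpow n -> tpow n ⨂ H with
  | 0 => fun c => rcoact C c
  | n'.+1 => fun x => \tens_(c, y <- x)
      \tens_(c0, c1 <- rcoact C c) \tens_(y0, y1 <- diag_coact y)
        (c0 ⊗ y0) ⊗ (c1 * y1)
  end.

(* c_0 ⊗ ... ⊗ c_n |-> c_0 ⊗ ... ⊗ Delta(c_i) ⊗ ... ⊗ c_n, for i <= n *)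
Fixpoint comul_at (n i : nat) {struct n} : tpow n -> tpow n.+1 :=
  match n return tpow n -> tpow n.+1 with
  | 0 => fun c => comul C c
  | n'.+1 => fun x => \tens_(c, y <- x)
      match i with
      | 0 => \tens_(c1, c2 <- comul C c) c1 ⊗ (c2 ⊗ y)
      | i'.+1 => c ⊗ comul_at i' y
      end
  end.

(* c_0 ⊗ ... ⊗ c_n.+1 |-> eps(c_i) c_0 ⊗ ... ⊗ c_n.+1 with c_i omitted,
   for i <= n.+1 *)
Fixpoint counit_at (n i : nat) {struct n} : tpow n.+1 -> tpow n :=
  match i, n return tpow n.+1 -> tpow n with
  | 0, _ => fun x => \tens_(c, y <- x) counit C c *: y
  | i'.+1, 0 => fun x => \tens_(c, y <- x) counit C y *: c
  | i'.+1, n'.+1 => fun x => \tens_(c, y <- x) c ⊗ counit_at i' y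
  end.

(* c_0 ⊗ ... ⊗ c_n, d |-> c_0 ⊗ ... ⊗ c_n ⊗ d *)
Fixpoint append (n : nat) : tpow n -> C -> tpow n.+1 :=
  match n return tpow n -> C -> tpow n.+1 with
  | 0 => fun c d => c ⊗ d
  | n'.+1 => fun x d => \tens_(c, y <- x) c ⊗ append y d
  end.

Lemma diag_coact_linear n : linear (@diag_coact n).
Proof. by elim: n => [|n IHn] /=; lin. Qed.
HB.instance Definition _ n :=
  GRing.isLinear.Build k (tpow n) (tpow n ⨂ H) _ (@diag_coact n)
    (@diag_coact_linear n).

Lemma comul_at_linear n i : linear (@comul_at n i).
Proof. by elim: n i => [|n IHn] [|i] /=; lin. Qed.
HB.instance Definition _ n i :=
  GRing.isLinear.Build k (tpow n) (tpow n.+1) _ (@comul_at n i)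
    (@comul_at_linear n i).

Lemma counit_at_linear n i : linear (@counit_at n i).
Proof. by elim: n i => [|n IHn] [|i] /=; lin. Qed.
HB.instance Definition _ n i :=
  GRing.isLinear.Build k (tpow n.+1) (tpow n) _ (@counit_at n i)
    (@counit_at_linear n i).

Lemma append_bilinear n : bilinear_for *:%R *:%R (@append n).
Proof.
elim: n => [|n [IHl IHr]]; first exact: tens_bilinear.
by split=> /= [d|x]; lin.
Qed.

Lemma lin_appendl (X : lmodType k) n (g : X -> tpow n) d :
  linear g -> linear (fun x => append (g x) d).
Proof. by move=> gl a x y; rewrite gl (append_bilinear n).1. Qed.

Lemma lin_appendr (X : lmodType k) n y (g : X -> C) :
  linear g -> linear (fun x => append (y : tpow n) (g x)).
Proof. by move=> gl a x z; rewrite gl (append_bilinear n).2. Qed.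

Ltac lin_hook ::= first
  [ apply: lin_actl | apply: lin_actr
  | apply: lin_appendl | apply: lin_appendr ].

Section Cochains.
Variable M : modcomod H.

(* c_0 ⊗ ... ⊗ c_n ⊗ m |->
   c_0^(2) ⊗ c_1 ⊗ ... ⊗ c_n ⊗ (c_0^(1))_0 ⊗ m (c_0^(1))_1 *)
Definition last_coface (n : nat) : tpow n ⨂ M -> tpow n.+1 ⨂ M :=
  match n return tpow n ⨂ M -> tpow n.+1 ⨂ M with
  | 0 => fun x => \tens_(c, m <- x) \tens_(c1, c2 <- comul C c)
      \tens_(a0, a1 <- rcoact C c1) (c2 ⊗ a0) ⊗ act m a1
  | n'.+1 => fun x => \tens_(z, m <- x) \tens_(c, y <- z)
      \tens_(c1, c2 <- comul C c) \tens_(a0, a1 <- rcoact C c1)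
        (c2 ⊗ append y a0) ⊗ act m a1
  end.

Definition coface (n i : nat) (x : tpow n ⨂ M) : tpow n.+1 ⨂ M :=
  if (i <= n)%N then \tens_(y, m <- x) comul_at i y ⊗ m else last_coface x.

Definition codegen (n i : nat) (x : tpow n.+1 ⨂ M) : tpow n ⨂ M :=
  \tens_(y, m <- x) counit_at i.+1 y ⊗ m.

(* c_0 ⊗ ... ⊗ c_n ⊗ m |-> c_1 ⊗ ... ⊗ c_n ⊗ (c_0)_0 ⊗ m (c_0)_1 *)
Definition cyclic_op (n : nat) : tpow n ⨂ M -> tpow n ⨂ M :=
  match n return tpow n ⨂ M -> tpow n ⨂ M with
  | 0 => fun x => \tens_(c, m <- x) \tens_(c0, c1 <- rcoact C c)
      c0 ⊗ act m c1
  | n'.+1 => fun x => \tens_(z, m <- x) \tens_(c, y <- z)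
      \tens_(c0, c1 <- rcoact C c) append y c0 ⊗ act m c1
  end.

Lemma coface_linear n i : linear (@coface n i).
Proof.
by rewrite /coface; case: (i <= n)%N; last (case: n => [|n] /=); lin.
Qed.

Lemma codegen_linear n i : linear (@codegen n i).
Proof. by rewrite /codegen; lin. Qed.

Lemma cyclic_op_linear n : linear (@cyclic_op n).
Proof. by case: n => [|n] /=; lin. Qed.

Definition cochains (n : nat) : lmodType k :=
  cotensor (@diag_coact n) (lcoact M).

Definition SAYD : Prop :=
  (forall (c : C) (m : M),
     \tens_(c0, c1 <- rcoact C c) c0 ⊗ lcoact M (act m c1)
     = \tens_(c0, h <- rcoact C c)
         \tens_(h1, h' <- hcomul H h) \tens_(h2, h3 <- hcomul H h')
         \tens_(m1, m0 <- lcoact M m)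
           c0 ⊗ ((antipode H h3 * m1 * h1) ⊗ act m0 h2))
  /\ (forall (n : nat) (x : cochains n),
     \tens_(y, m <- cotensor_val x) \tens_(y0, y1 <- diag_coact y)
       y0 ⊗ act m y1
     = cotensor_val x).

Definition HCC : Prop :=
  exists (d : forall n, nat -> {linear cochains n -> cochains n.+1})
         (s : forall n, nat -> {linear cochains n.+1 -> cochains n})
         (t : forall n, {linear cochains n -> cochains n}),
  [/\ forall n i (x : cochains n), (i <= n.+1)%N ->
        cotensor_val (d n i x) = coface i (cotensor_val x),
      forall n i (x : cochains n.+1), (i <= n)%N ->
        cotensor_val (s n i x) = codegen i (cotensor_val x),
      forall n (x : cochains n),
        cotensor_val (t n x) = cyclic_op (cotensor_val x)
    & cocyclic d s t].

End Cochains.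

End Operators.

(* Main.v *)
(* Apart from two of them, the required identities hold on the whole spaces
   C^(n+1) ⊗ M, before passing to the cotensor product.  The last coface is
   tau \o delta_0, so the identities involving it follow from those between
   inner operators and from the two relations tau \o delta_(i+1) = delta_i \o tau
   and sigma_n \o tau = (counit on the first factor).
   That tau preserves the cotensor product uses condition (i): on a cotensor
   c ⊗ y ⊗ m one may replace m_(-1) by c_1 y_1, and then S(c_1^(3)) cancels
   against c_1^(4).  Finally tau^(n+1) is y ⊗ m |-> y_0 ⊗ m y_1 on the whole
   space, which is the identity on the cotensor product by condition (ii). *)
Require Import Defs.
From HB Require Import structures.
From mathcomp Require Import all_boot all_algebra.

Set Implicit Arguments.
Unset Strict Implicit.
Unset Printing Implicit Defensive.

Import GRing.Theory.
Local Open Scope ring_scope.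
Local Open Scope tens_scope.

(** * Automation of linearity goals *)

Lemma lin_comp (k : fieldType) (X V W : lmodType k) (f : V -> W) (g : X -> V) :
  linear f -> linear g -> linear (fun x => f (g x)).
Proof. by move=> fl gl a x y; rewrite gl fl. Qed.

Lemma tens_linear (k : fieldType) (V W : lmodType k) (v : V) :
  linear (tens (W := W) v).
Proof. by lin. Qed.

(** The hook extends [lin] to operators known to be linear only through a lemma, and to generic
    summands whose linearity is a hypothesis in the context; the latter are peeled off by
    [lin_comp]. *)
Ltac lin_hook ::= first
  [ exact: tens_linear | exact: comul_at_linear | exact: counit_at_linear
  | exact: coface_linear | exact: codegen_linear | exact: cyclic_op_linear
  | match goal with
    | h : linear _ |- _ => apply: (lin_comp h)
    | h : forall _ _, linear _ |- _ => apply: (lin_comp (h _ _))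
    end
  | apply: lin_actl | apply: lin_actr
  | apply: lin_appendl | apply: lin_appendr ].

(** * Calculus of Sweedler sums over tensors *)

Section Tensors.
Context {k : fieldType}.
Implicit Types (U V W X Y Z : lmodType k).

(** [tlift] is a finite sum over a chosen representative of [t], so summands may be rewritten
    pointwise for arbitrary [f] and [g]. *)
Lemma eq_tlift V W (U : zmodType) (f g : V -> W -> U) t :
  (forall v w, f v w = g v w) -> tlift f t = tlift g t.
Proof. by move=> fg; apply: eq_bigr => p _. Qed.

Lemma tlift_exchange V W X Y (U : zmodType) (f : V -> W -> X -> Y -> U) s t :
  \tens_(v, w <- s) \tens_(x, y <- t) f v w x y =
  \tens_(x, y <- t) \tens_(v, w <- s) f v w x y.
Proof. exact: exchange_big. Qed.

Lemma linear_tlift V W X Y (L : X -> Y) (f : V -> W -> X) t :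
  linear L -> L (tlift f t) = \tens_(v, w <- t) L (f v w).
Proof.
move=> Ll; have L0 : L 0 = 0.
  by have := Ll (-1) 0 0; rewrite !scaleN1r !addNr.
have LD : {morph L : x y / x + y}.
  by move=> x y; rewrite -[x in LHS]scale1r Ll scale1r.
exact: (big_morph L LD L0).
Qed.

(** Bilinearity of the outer [f] makes its sum independent of the representative chosen for the
    inner tensor. This is the flattening rule for nested Sweedler sums used throughout. *)
Lemma tlift_tlift V W X Y U (f : V -> W -> U) (g : X -> Y -> V ⨂ W) t :
  bilinear_for *:%R *:%R f ->
  tlift f (tlift g t) = \tens_(x, y <- t) tlift f (g x y).
Proof. by move=> bf; apply: linear_tlift; apply: tlift_linear. Qed.

(** Elementary tensors span, so linear maps are compared on them. Most identities below are reduced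
    this way, one tensor factor at a time. *)
Lemma tens_ext V W U (f g : V ⨂ W -> U) :
  linear f -> linear g -> (forall v w, f (v ⊗ w) = g (v ⊗ w)) ->
  f =1 g.
Proof.
move=> fl gl fg t; rewrite (tensE t) (linear_tlift _ _ fl) (linear_tlift _ _ gl).
exact: eq_tlift.
Qed.

Lemma linear0P U V (f : U -> V) : linear f -> f 0 = 0.
Proof. by move=> fl; have := fl (-1) 0 0; rewrite !scaleN1r !addNr. Qed.

Lemma linearZP U V (f : U -> V) a u : linear f -> f (a *: u) = a *: f u.
Proof. by move=> fl; have := fl a u 0; rewrite !addr0 linear0P // addr0. Qed.

Lemma tensZl V W (a : k) (v : V) (w : W) : (a *: v) ⊗ w = a *: (v ⊗ w).
Proof. by rewrite (linearZP _ _ (f := fun v => v ⊗ w)) //; lin. Qed.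

Lemma scaler_tlift V W U (f : V -> W -> U) (a : k) t :
  a *: tlift f t = \tens_(v, w <- t) (a *: f v w).
Proof. exact: scaler_sumr. Qed.
End Tensors.

(** * Coassociativity, counit and antipode under a multilinear summand *)

Section Sweedler.
Context {k : fieldType}.
Implicit Types (U V W X : lmodType k).

Section Coassociativity.
Variables (V : lmodType k) (D : {linear V -> V ⨂ V}) (e : {scalar V}).
Hypothesis ax : coalgebra_axioms D e.

(** The trilinear [F] induces a linear map [L] on V ⊗ (V ⊗ V); applying [L] to the coassociativity
    axiom gives the claim. *)
Lemma sweedlerA U (F : V -> V -> V -> U) c :
  (forall b c, linear (fun a => F a b c)) ->
  (forall a c, linear (fun b => F a b c)) ->
  (forall a b, linear (fun c => F a b c)) ->
  \tens_(a, b <- D c) \tens_(a1, a2 <- D a) F a1 a2 b =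
  \tens_(a, b <- D c) \tens_(b1, b2 <- D b) F a b1 b2.
Proof.
move=> F1 F2 F3.
pose L (t : V ⨂ (V ⨂ V)) := \tens_(a, u <- t) \tens_(b, c <- u) F a b c.
have bL : bilinear_for *:%R *:%R (fun a u => \tens_(b, c <- u) F a b c).
  by split; lin.
have := congr1 L (comulA ax c).
rewrite /L !tlift_tlift // => E.
transitivity (\tens_(x, y <- D c)
  (\tens_(a, u <- \tens_(a1, a2 <- D x) a1 ⊗ (a2 ⊗ y))
     \tens_(b, c <- u) F a b c)).
  apply: eq_tlift => a b; rewrite tlift_tlift //; apply: eq_tlift => a1 a2.
  by rewrite tliftE // tliftE //; split; lin.
by rewrite E; apply: eq_tlift => a b; rewrite tliftE.
Qed.

Lemma sweedler_counitl U (F : V -> U) c :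
  linear F -> \tens_(a, b <- D c) e a *: F b = F c.
Proof.
move=> Fl; rewrite -[in RHS](counitl ax c) (linear_tlift _ _ Fl).
by apply: eq_tlift => a b; rewrite linearZP.
Qed.

Lemma sweedler_counitr U (F : V -> U) c :
  linear F -> \tens_(a, b <- D c) e b *: F a = F c.
Proof.
move=> Fl; rewrite -[in RHS](counitr ax c) (linear_tlift _ _ Fl).
by apply: eq_tlift => a b; rewrite linearZP.
Qed.
End Coassociativity.

Variable H : hopfAlgebra k.

(** Reassociating twice makes h_3 and h_4 the two halves of a single coproduct. Then S(h_3) h_4
    becomes a counit, which the counit axiom absorbs into h_2. *)
Lemma hopf_cancel U (F : H -> H -> H -> U) h b :
  (forall b c, linear (fun a => F a b c)) ->
  (forall a c, linear (fun b => F a b c)) ->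
  (forall a b, linear (fun c => F a b c)) ->
  \tens_(h', h4 <- hcomul H h) \tens_(h1, h'' <- hcomul H h')
    \tens_(h2, h3 <- hcomul H h'')
      F h1 h2 (antipode H h3 * (h4 * b)) =
  \tens_(h1, h2 <- hcomul H h) F h1 h2 b.
Proof.
move=> F1 F2 F3.
rewrite (sweedlerA (hopf_coalgebra H) (F := fun x y z =>
  \tens_(h2, h3 <- hcomul H y) F x h2 (antipode H h3 * (z * b)))); try by lin.
apply: eq_tlift => h1 h''.
rewrite (sweedlerA (hopf_coalgebra H) (F := fun x y z =>
   F h1 x (antipode H y * (z * b)))); try by lin.
transitivity (\tens_(h2, u <- hcomul H h'') (hcounit H u *: F h1 h2 b)).
  apply: eq_tlift => h2 u; have Fl : linear (fun x => F h1 h2 (x * b)) by lin.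
  rewrite -[in RHS](mul1r b) -(linearZP _ _ Fl) -antipodel.
  by rewrite [RHS](linear_tlift _ _ Fl); apply: eq_tlift => x y; rewrite mulrA.
by rewrite (sweedler_counitr (hopf_coalgebra H) (F := fun x => F h1 x b)); try lin.
Qed.

(** Analogue of [sweedlerA] for a coaction: [F] induces a linear map on V ⊗ H ⊗ H, which is applied
    to [rcoactA]. *)
Lemma sweedler_rcoact U (V : lmodType k) (r : {linear V -> V ⨂ H})
    (F : V -> H -> H -> U) v :
  right_coaction_axioms r ->
  (forall b c, linear (fun a => F a b c)) ->
  (forall a c, linear (fun b => F a b c)) ->
  (forall a b, linear (fun c => F a b c)) ->
  \tens_(v0, h <- r v) \tens_(v00, h0 <- r v0) F v00 h0 h =
  \tens_(v0, h <- r v) \tens_(h1, h2 <- hcomul H h) F v0 h1 h2.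
Proof.
move=> ax F1 F2 F3.
pose L (t : V ⨂ H ⨂ H) := \tens_(u, c <- t) \tens_(a, b <- u) F a b c.
have bL : bilinear_for *:%R *:%R (fun u c => \tens_(a, b <- u) F a b c).
  by split; lin.
have := congr1 L (rcoactA ax v).
rewrite /L !tlift_tlift // => E.
transitivity (\tens_(x, y <- r v)
  (\tens_(u, c <- r x ⊗ y) \tens_(a, b <- u) F a b c)).
  by apply: eq_tlift => a b; rewrite tliftE.
rewrite E; apply: eq_tlift => a b; rewrite tlift_tlift //.
by apply: eq_tlift => a1 a2; rewrite tliftE // tliftE //; split; lin.
Qed.
End Sweedler.

(** * Values of the recursive operators on elementary tensors *)

Section Unfolding.
Context {k : fieldType} {H : hopfAlgebra k} (C : comodCoalgebra H).
Implicit Types (n i j : nat) (c : C).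
Local Notation T := (tpow C).

Lemma comul_at00E i (c : T 0) : comul_at i c = comul C c.
Proof. by []. Qed.

Lemma append0E (c d : C) : append (c : T 0) d = c ⊗ d.
Proof. by []. Qed.

Lemma comul_at0E n c (y : T n) :
  comul_at (n := n.+1) 0 (c ⊗ y) = \tens_(c1, c2 <- comul C c) c1 ⊗ (c2 ⊗ y).
Proof. by rewrite /= tliftE //; split; lin. Qed.

Lemma comul_atSE n i c (y : T n) :
  comul_at (n := n.+1) i.+1 (c ⊗ y) = c ⊗ comul_at i y.
Proof. by rewrite /= tliftE //; split; lin. Qed.

Lemma counit_at0E n c (y : T n) :
  counit_at 0 (c ⊗ y : T n.+1) = counit C c *: y.
Proof. by case: n y => [|n] y; rewrite /= tliftE //; split; lin. Qed.

Lemma counit_at1E i c c' :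
  counit_at i.+1 (c ⊗ c' : T 1) = counit C c' *: c.
Proof. by rewrite /= tliftE //; split; lin. Qed.

Lemma counit_atSE n i c (y : T n.+1) :
  counit_at i.+1 (c ⊗ y : T n.+2) = c ⊗ counit_at i y.
Proof. by rewrite /= tliftE //; split; lin. Qed.

Lemma appendSE n c (y : T n) d :
  append (c ⊗ y : T n.+1) d = c ⊗ append y d.
Proof. by rewrite /= tliftE //; split; lin. Qed.

Lemma diag_coactSE n c (y : T n) :
  diag_coact (c ⊗ y : T n.+1) = \tens_(c0, c1 <- rcoact C c)
    \tens_(y0, y1 <- diag_coact y) (c0 ⊗ y0) ⊗ (c1 * y1).
Proof. by rewrite /= tliftE //; split; lin. Qed.

Lemma diag_coact0E (c : T 0) : diag_coact c = rcoact C c.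
Proof. by []. Qed.
End Unfolding.

Arguments comul_at : simpl never.
Arguments counit_at : simpl never.
Arguments append : simpl never.
Arguments diag_coact : simpl never.

(** * Comultiplication and counit on tensor powers of C *)

Section TensorPowers.
Context {k : fieldType} {H : hopfAlgebra k} (C : comodCoalgebra H).
Implicit Types (n i j : nat) (c : C).
Local Notation T := (tpow C).

Lemma comul_at_append n i (y : T n) c : (i <= n)%N ->
  comul_at i (append y c) = append (comul_at i y) c.
Proof.
elim: n i y => [|n IHn] [|i] // y.
- move=> _; rewrite comul_at00E append0E comul_at0E.
  rewrite [X in append X c]tensE.
  rewrite (linear_tlift (L := @append _ _ _ 1 ^~ c)); last by lin.
  by apply: eq_tlift => a b; rewrite appendSE.
- move=> _; move: y; apply: tens_ext; [by lin..|move=> d y].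
  rewrite appendSE !comul_at0E.
  rewrite (linear_tlift (L := @append _ _ _ n.+2 ^~ c)); last by lin.
  by apply: eq_tlift => a b; rewrite !appendSE.
- rewrite ltnS => lei; move: y; apply: tens_ext; [by lin..|move=> d y].
  by rewrite appendSE !comul_atSE IHn // appendSE.
Qed.

Lemma comul_at_append_last n (y : T n) c :
  comul_at n.+1 (append y c) =
  \tens_(c1, c2 <- comul C c) append (append y c1) c2.
Proof.
elim: n y => [|n IHn] y.
  rewrite append0E comul_atSE comul_at00E [X in _ ⊗ X]tensE.
  rewrite (linear_tlift (L := tens _)); last by lin.
  by apply: eq_tlift => a b; rewrite append0E appendSE append0E.
move: y; apply: tens_ext; [by lin..|move=> d y].
rewrite appendSE comul_atSE IHn (linear_tlift (L := tens _)); last by lin.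
by apply: eq_tlift => a b; rewrite !appendSE.
Qed.

Lemma counit_at_append n i (y : T n.+1) c : (i <= n.+1)%N ->
  counit_at i (append y c) = append (counit_at i y) c.
Proof.
have Z m (d : C) (a : k) (z : T m) : append (a *: z) d = a *: append z d.
  by rewrite (linearZP (f := @append _ _ _ m ^~ d)) //; lin.
elim: n i y => [|n IHn] [|i] y.
- move=> _; move: y; apply: tens_ext; [by lin..|move=> d y].
  by rewrite appendSE !counit_at0E Z.
- rewrite ltnS leqn0 => /eqP ->; move: y; apply: tens_ext; [by lin..|move=> d y].
  rewrite appendSE append0E counit_atSE counit_at0E counit_at1E Z.
  by rewrite (linearZP (f := tens _)) //; lin.
- move=> _; move: y; apply: tens_ext; [by lin..|move=> d y].
  by rewrite appendSE !counit_at0E Z.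
- rewrite ltnS => lei; move: y; apply: tens_ext; [by lin..|move=> d y].
  by rewrite appendSE !counit_atSE IHn // appendSE.
Qed.

Lemma counit_at_append_last n (y : T n) c :
  counit_at n.+1 (append y c) = counit C c *: y.
Proof.
elim: n y => [|n IHn] y; first by rewrite append0E counit_at1E.
move: y; apply: tens_ext; [by lin..|move=> d y].
by rewrite appendSE counit_atSE IHn (linearZP (f := tens _)) //; lin.
Qed.

(** Coassociativity enters only when both indices point at the same factor. After the leading
    factors are stripped by induction, the other cases act on separate factors. *)
Lemma comul_at_comul_at n i j (x : T n) : (i <= j <= n)%N ->
  comul_at j.+1 (comul_at i x) = comul_at i (comul_at j x).
Proof.
elim: n i j x => [|n IHn] [|i] [|j] x; rewrite ?ltnS // => leij.
- rewrite !comul_at00E [X in comul_at 1 X]tensE [X in comul_at 0 X]tensE.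
  rewrite (linear_tlift (L := comul_at 1)); last by lin.
  rewrite (linear_tlift (L := comul_at 0)); last by lin.
  transitivity (\tens_(a, b <- comul C x) a ⊗ comul C b).
    by apply: eq_tlift => a b; rewrite comul_atSE.
  rewrite -(comulA (cc_coalgebra C)).
  by apply: eq_tlift => a b; rewrite comul_at0E.
- move: x; apply: tens_ext; [by lin..|move=> d y].
  rewrite comul_at0E.
  rewrite (linear_tlift (L := comul_at 1)); last by lin.
  rewrite (linear_tlift (L := comul_at 0)); last by lin.
  transitivity (\tens_(a, b <- comul C d) \tens_(b1, b2 <- comul C b)
      a ⊗ (b1 ⊗ (b2 ⊗ y))).
    apply: eq_tlift => a b; rewrite comul_atSE comul_at0E.
    by rewrite (linear_tlift (L := tens _)) //; lin.
  rewrite -(sweedlerA (cc_coalgebra C)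
    (F := fun a b1 b2 => a ⊗ (b1 ⊗ (b2 ⊗ y)))); try by lin.
  by apply: eq_tlift => a b; rewrite comul_at0E.
- move: x; apply: tens_ext; [by lin..|move=> d y].
  rewrite comul_atSE !comul_at0E.
  rewrite (linear_tlift (L := comul_at _)); last by lin.
  by apply: eq_tlift => a b; rewrite !comul_atSE.
- move: x; apply: tens_ext; [by lin..|move=> d y].
  by rewrite !comul_atSE IHn.
Qed.

(** The codegeneracy σ_i applies the counit to factor i+1, so it is [counit_at i.+1]. Index 0 is
    included here because the induction strips leading factors and lowers the indices. *)
Lemma counit_at_counit_at n i j (x : T n.+2) : (i <= j <= n.+1)%N ->
  counit_at j (counit_at i x) = counit_at i (counit_at j.+1 x).
Proof.
elim: n i j x => [|n IHn] [|i] [|j] x; rewrite ?ltnS // => leij;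
  move: x; apply: tens_ext; try (by lin); move=> d y.
- rewrite counit_at0E counit_atSE counit_at0E.
  by rewrite (linearZP (f := counit_at _)) //; lin.
- rewrite counit_at0E counit_atSE counit_at0E.
  by rewrite (linearZP (f := counit_at _)) //; lin.
(* With three factors in all, the bound forces both remaining indices to be 0; the counits of the
   last two factors are then scalars that commute. *)
- have [-> ->] : i = 0%N /\ j = 0%N
    by case: i j leij => [|i] [|j] //; rewrite andbF.
  rewrite !counit_atSE; move: y; apply: tens_ext; [by lin..|move=> b c].
  rewrite counit_at0E counit_at1E.
  rewrite !(linearZP (f := tens _)); try by lin.
  rewrite !(linearZP (f := counit_at 1)); try by lin.
  by rewrite !counit_at1E scalerA mulrC -scalerA.
- rewrite counit_at0E counit_atSE counit_at0E.
  by rewrite (linearZP (f := counit_at _)) //; lin.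
- rewrite counit_at0E counit_atSE counit_at0E.
  by rewrite (linearZP (f := counit_at _)) //; lin.
- by rewrite !counit_atSE IHn.
Qed.

Lemma counit_at_comul_at_lt n i j (x : T n.+1) : (i <= j <= n)%N ->
  counit_at j.+2 (comul_at i x) = comul_at i (counit_at j.+1 x).
Proof.
elim: n i j x => [|n IHn] [|i] [|j] x; rewrite ?ltnS ?ltn0 ?andbF // => leij;
  move: x; apply: tens_ext; try (by lin); move=> d y.
- rewrite counit_at1E (linearZP (f := comul_at _)); last by lin.
  rewrite comul_at00E comul_at0E [in RHS](tensE (comul C d)).
  rewrite (linear_tlift (L := counit_at _)); last by lin.
  rewrite scaler_tlift; apply: eq_tlift => a b.
  by rewrite counit_atSE counit_at1E (linearZP (f := tens _)) //; lin.
- rewrite counit_atSE !comul_at0E.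
  rewrite (linear_tlift (L := counit_at _)); last by lin.
  by apply: eq_tlift => a b; rewrite !counit_atSE.
- rewrite counit_atSE !comul_at0E.
  rewrite (linear_tlift (L := counit_at _)); last by lin.
  by apply: eq_tlift => a b; rewrite !counit_atSE.
- by rewrite comul_atSE !counit_atSE comul_atSE IHn.
Qed.

(** The counit hits the second half of Δ(c_j), so this is the right counit axiom in factor j. *)
Lemma counit_at_comul_atr n j (x : T n) : (j <= n)%N ->
  counit_at j.+1 (comul_at j x) = x.
Proof.
elim: n j x => [|n IHn] [|j] x; rewrite ?ltnS ?ltn0 ?andbF // => leij.
- rewrite comul_at00E -[in RHS](counitr (cc_coalgebra C) x).
  rewrite [X in counit_at 1 X](tensE (comul C x)).
  rewrite (linear_tlift (L := counit_at _)); last by lin.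
  by apply: eq_tlift => a b; rewrite counit_at1E.
- move: x; apply: tens_ext; [by lin..|move=> d y].
  rewrite comul_at0E (linear_tlift (L := counit_at _)); last by lin.
  rewrite -(sweedler_counitr (cc_coalgebra C) (F := fun a => a ⊗ y)); last by lin.
  apply: eq_tlift => a b; rewrite counit_atSE counit_at0E.
  by rewrite (linearZP (f := tens _)) //; lin.
- move: x; apply: tens_ext; [by lin..|move=> d y].
  by rewrite comul_atSE counit_atSE IHn.
Qed.

(** The counit hits the first half of Δ(c_j), so this is the left counit axiom in factor j. *)
Lemma counit_at_comul_atl n j (x : T n) : (j <= n)%N ->
  counit_at j (comul_at j x) = x.
Proof.
elim: n j x => [|n IHn] [|j] x; rewrite ?ltnS ?ltn0 ?andbF // => leij.
- rewrite comul_at00E -[in RHS](counitl (cc_coalgebra C) x).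
  rewrite [X in counit_at 0 X](tensE (comul C x)).
  rewrite (linear_tlift (L := counit_at _)); last by lin.
  by apply: eq_tlift => a b; rewrite counit_at0E.
- move: x; apply: tens_ext; [by lin..|move=> d y].
  rewrite comul_at0E (linear_tlift (L := counit_at _)); last by lin.
  rewrite -(sweedler_counitl (cc_coalgebra C) (F := fun a => a ⊗ y)); last by lin.
  by apply: eq_tlift => a b; rewrite counit_at0E.
- move: x; apply: tens_ext; [by lin..|move=> d y].
  by rewrite comul_atSE counit_atSE IHn.
Qed.

Lemma counit_at_comul_at_gt n i j (x : T n.+1) : (j <= i <= n)%N ->
  counit_at j (comul_at i.+1 x) = comul_at i (counit_at j x).
Proof.
elim: n i j x => [|n IHn] [|i] [|j] x; rewrite ?ltnS ?ltn0 ?andbF // => leij;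
  move: x; apply: tens_ext; try (by lin); move=> d y;
  rewrite comul_atSE ?counit_at0E;
  try by rewrite (linearZP (f := comul_at _)) //; lin.
by rewrite !counit_atSE comul_atSE IHn.
Qed.

(** * Colinearity for the diagonal coaction *)

Lemma diag_coact_append n (y : T n) c :
  diag_coact (append y c) = \tens_(y0, y1 <- diag_coact y)
    \tens_(c0, c1 <- rcoact C c) append y0 c0 ⊗ (y1 * c1).
Proof.
elim: n y => [|n IHn] y; first by rewrite append0E diag_coactSE.
move: y; apply: tens_ext; [by lin..|move=> d y].
rewrite appendSE !diag_coactSE tlift_tlift; last by split; lin.
apply: eq_tlift => d0 d1; rewrite IHn tlift_tlift; last by split; lin.
rewrite tlift_tlift; last by split; lin.
apply: eq_tlift => y0 y1; rewrite tlift_tlift; last by split; lin.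
rewrite tliftE; last by split; lin.
apply: eq_tlift => c0 c1; rewrite tliftE; last by split; lin.
by rewrite appendSE mulrA.
Qed.

(** At the head this is the comodule coalgebra axiom [rcoact_comul]; the factors in front of
    position i only multiply the H-component from the left. *)
Lemma diag_coact_comul_at n i (y : T n) :
  diag_coact (comul_at i y) =
  \tens_(y0, y1 <- diag_coact y) comul_at i y0 ⊗ y1.
Proof.
have base (c : T 0) : diag_coact (n := 1) (comul C c) =
    \tens_(c0, c1 <- rcoact C c) comul C c0 ⊗ c1.
  rewrite (rcoact_comul (c : C)) [in LHS](tensE (comul C c)).
  rewrite (linear_tlift (L := @diag_coact _ _ C 1)); last by lin.
  by apply: eq_tlift => a b; rewrite diag_coactSE !diag_coact0E.
elim: n i y => [|n IHn] [|i] y; [exact: base..| |].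
- move: y; apply: tens_ext; [by lin..|move=> d y].
  rewrite comul_at0E (linear_tlift (L := @diag_coact _ _ C n.+2)); last by lin.
  (* [L] sends a ⊗ b ⊗ h to (a ⊗ b ⊗ y_0) ⊗ h y_1, which transports the axiom for d to the tensor d
     ⊗ y. *)
  pose L (t : C ⨂ C ⨂ H) := \tens_(u, h <- t) \tens_(a, b <- u)
    \tens_(y0, y1 <- diag_coact y) (a ⊗ (b ⊗ y0)) ⊗ (h * y1).
  have bL : bilinear_for *:%R *:%R (fun u h => \tens_(a, b <- u)
    \tens_(y0, y1 <- diag_coact y) (a ⊗ (b ⊗ y0)) ⊗ (h * y1)).
    by split; lin.
  transitivity (L (\tens_(c0, c1 <- rcoact C d) comul C c0 ⊗ c1)).
    rewrite rcoact_comul /L tlift_tlift //; apply: eq_tlift => a b.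
    rewrite diag_coactSE tlift_tlift //; apply: eq_tlift => a0 a1.
    rewrite tlift_tlift //. rewrite diag_coactSE tlift_tlift; last by split; lin.
    apply: eq_tlift => b0 b1; rewrite tliftE // tliftE; last by split; lin.
    rewrite tlift_tlift; last by split; lin.
    apply: eq_tlift => y0 y1; rewrite tliftE; last by split; lin.
    by rewrite mulrA.
  rewrite /L tlift_tlift // diag_coactSE tlift_tlift; last by split; lin.
  apply: eq_tlift => d0 d1; rewrite tliftE // tlift_tlift; last by split; lin.
  rewrite -tlift_exchange; apply: eq_tlift => y0 y1.
  rewrite tliftE; last by split; lin.
  rewrite comul_at0E (linear_tlift (L := fun x => x ⊗ _)) //; lin.
- move: y; apply: tens_ext; [by lin..|move=> d y].
  rewrite comul_atSE !diag_coactSE tlift_tlift; last by split; lin.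
  apply: eq_tlift => d0 d1; rewrite IHn tlift_tlift; last by split; lin.
  rewrite [RHS]tlift_tlift; last by split; lin.
  apply: eq_tlift => y0 y1; rewrite !tliftE; try by split; lin.
  by rewrite comul_atSE.
Qed.

Lemma sweedler_rcoact_counit (U : lmodType k) (F : H -> U) c :
  linear F ->
  \tens_(c0, c1 <- rcoact C c) counit C c0 *: F c1 = counit C c *: F 1.
Proof.
move=> Fl; rewrite -(linearZP _ _ Fl) -rcoact_counit (linear_tlift _ _ Fl).
by apply: eq_tlift => a b; rewrite linearZP.
Qed.

Lemma diag_coact_counit_at n i (y : T n.+1) :
  diag_coact (counit_at i y) =
  \tens_(y0, y1 <- diag_coact y) counit_at i y0 ⊗ y1.
Proof.
have base m (z : T m.+1) : diag_coact (counit_at 0 z) =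
    \tens_(y0, y1 <- diag_coact z) counit_at 0 y0 ⊗ y1.
  move: z; apply: tens_ext; [by lin..|move=> d z].
  rewrite counit_at0E diag_coactSE tlift_tlift; last by split; lin.
  (* Since ε(d_0) d_1 = ε(d) 1, the H-component ε(d_0) d_1 y_1 collapses to ε(d) y_1. *)
  transitivity (\tens_(d0, d1 <- rcoact C d)
      counit C d0 *: \tens_(y0, y1 <- diag_coact z) y0 ⊗ (d1 * y1)).
    rewrite (sweedler_rcoact_counit (F := fun h =>
      \tens_(y0, y1 <- diag_coact z) y0 ⊗ (h * y1))); last by lin.
    rewrite (linearZP (f := @diag_coact _ _ C m)); last by lin.
    congr (_ *: _); rewrite [LHS]tensE; apply: eq_tlift => a b.
    by rewrite mul1r.
  apply: eq_tlift => d0 d1; rewrite tlift_tlift; last by split; lin.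
  rewrite scaler_tlift; apply: eq_tlift => y0 y1.
  by rewrite tliftE ?counit_at0E ?tensZl //; split; lin.
elim: n i y => [|n IHn] [|i] y; [exact: base| |exact: base|].
- move: y; apply: tens_ext; [by lin..|move=> c d].
  rewrite counit_at1E diag_coactSE tlift_tlift; last by split; lin.
  transitivity (\tens_(c0, c1 <- rcoact C c) counit C d *: (c0 ⊗ c1)).
    rewrite -scaler_tlift -tensE.
    by rewrite (linearZP (f := @diag_coact _ _ C 0)) //; lin.
  apply: eq_tlift => c0 c1; rewrite tlift_tlift; last by split; lin.
  (* The erased factor d is the last one, so the unit is inserted on the right of c_1 and ε(d) 1 is
     expanded back into ε(d_0) d_1. *)
  rewrite -[c1 in LHS]mulr1.
  rewrite -(sweedler_rcoact_counit (F := fun x => c0 ⊗ (c1 * x))); last by lin.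
  apply: eq_tlift => d0 d1; rewrite tliftE; last by split; lin.
  by rewrite counit_at1E tensZl.
- move: y; apply: tens_ext; [by lin..|move=> d y].
  rewrite counit_atSE !diag_coactSE tlift_tlift; last by split; lin.
  apply: eq_tlift => d0 d1; rewrite IHn tlift_tlift; last by split; lin.
  rewrite [RHS]tlift_tlift; last by split; lin.
  apply: eq_tlift => y0 y1; rewrite !tliftE; try by split; lin.
  by rewrite counit_atSE.
Qed.

(* The first factor is moved to the end and its coaction component is kept
   apart, so that the cyclic operator is [y ⊗ m |-> y_0 ⊗ m y_1]. *)
Definition rotate n : T n -> T n ⨂ H :=
  match n return T n -> T n ⨂ H with
  | 0 => fun c => rcoact C c
  | n'.+1 => fun x => \tens_(c, y <- x)
      \tens_(c0, c1 <- rcoact C c) append y c0 ⊗ c1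
  end.

Lemma rotate_linear n : linear (@rotate n).
Proof. by case: n => [|n] /=; lin. Qed.
HB.instance Definition _ n :=
  GRing.isLinear.Build k (T n) (T n ⨂ H) _ (@rotate n) (@rotate_linear n).

Lemma rotate0E (c : T 0) : rotate c = rcoact C c.
Proof. by []. Qed.

Lemma rotateSE n c (y : T n) :
  rotate (c ⊗ y : T n.+1) = \tens_(c0, c1 <- rcoact C c) append y c0 ⊗ c1.
Proof. by rewrite /= tliftE //; split; lin. Qed.

Arguments rotate : simpl never.

(** * Rotation against comultiplication, counit and coaction *)

Lemma rotate_comul_at n i (y : T n) : (i < n)%N ->
  rotate (comul_at i.+1 y) = \tens_(v, h <- rotate y) comul_at i v ⊗ h.
Proof.
case: n y => [|n] // y; rewrite ltnS => lein.
move: y; apply: tens_ext; [by lin..|move=> c y].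
rewrite comul_atSE !rotateSE tlift_tlift; last by split; lin.
apply: eq_tlift => c0 c1; rewrite tliftE; last by split; lin.
by rewrite comul_at_append.
Qed.

Lemma rotate_counit_at n i (y : T n.+1) : (i <= n)%N ->
  rotate (counit_at i.+1 y) = \tens_(v, h <- rotate y) counit_at i v ⊗ h.
Proof.
case: n y => [|n] y => [|lein].
  rewrite leqn0 => /eqP ->; move: y; apply: tens_ext; [by lin..|move=> c d].
  rewrite counit_at1E (linearZP (f := @rotate 0)); last by lin.
  rewrite rotateSE rotate0E tlift_tlift; last by split; lin.
  rewrite [in LHS](tensE (rcoact C c)) scaler_tlift.
  apply: eq_tlift => c0 c1; rewrite tliftE; last by split; lin.
  by rewrite append0E counit_at0E tensZl.
move: y; apply: tens_ext; [by lin..|move=> c y].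
rewrite counit_atSE !rotateSE tlift_tlift; last by split; lin.
apply: eq_tlift => c0 c1; rewrite tliftE; last by split; lin.
by rewrite counit_at_append.
Qed.

(** The axiom [rcoact_comul] produces the product a_1 b_1 in H, and acting by a product means acting
    by a_1 and then by b_1. This is the form needed to compare one rotation of c with two rotations
    of the halves of Δ(c). *)
Lemma rcoact_comul_act (M : modcomod H) (V : lmodType k)
    (F : C -> C -> V) c (m : M) :
  (forall b, linear (F^~ b)) -> (forall a, linear (F a)) ->
  \tens_(c0, h <- rcoact C c) \tens_(a, b <- comul C c0) F a b ⊗ act m h =
  \tens_(a, b <- comul C c) \tens_(a0, a1 <- rcoact C a)
    \tens_(b0, b1 <- rcoact C b) F a0 b0 ⊗ act (act m a1) b1.
Proof.
move=> Fl Fr.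
pose L (t : C ⨂ C ⨂ H) :=
  \tens_(u, h <- t) \tens_(a, b <- u) F a b ⊗ act m h.
have bL : bilinear_for *:%R *:%R
    (fun u h => \tens_(a, b <- u) F a b ⊗ act m h) by split; lin.
transitivity (L (\tens_(c0, c1 <- rcoact C c) comul C c0 ⊗ c1)).
  by rewrite /L tlift_tlift //; apply: eq_tlift => a b; rewrite tliftE.
rewrite rcoact_comul /L tlift_tlift //; apply: eq_tlift => a b.
rewrite tlift_tlift //; apply: eq_tlift => a0 a1.
rewrite tlift_tlift //; apply: eq_tlift => b0 b1.
by rewrite tliftE // tliftE ?actM //; split; lin.
Qed.

(** By coassociativity of the coaction, the left side involves four legs h_1, ..., h_4 of one
    element, with c_1 = h_4. Then S(h_3) h_4 cancels by [hopf_cancel], leaving b h_1 ⊗ h_2. *)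
Lemma rcoact_twist (V : lmodType k) (G : C -> V) c (b : H) : linear G ->
  \tens_(c0, c1 <- rcoact C c) \tens_(v, h <- rcoact C c0)
    \tens_(h1, h' <- hcomul H h) \tens_(h2, h3 <- hcomul H h')
      G v ⊗ ((antipode H h3 * (c1 * b) * h1) ⊗ h2) =
  \tens_(c0, c1 <- rcoact C c) \tens_(v, h <- rcoact C c0)
    G v ⊗ ((b * h) ⊗ c1).
Proof.
move=> Gl.
rewrite (sweedler_rcoact (F := fun (v : C) (h c1 : H) =>
  \tens_(h1, h' <- hcomul H h) \tens_(h2, h3 <- hcomul H h')
      G v ⊗ ((antipode H h3 * (c1 * b) * h1) ⊗ h2)) c (rcoact_axioms C)); try by lin.
rewrite (sweedler_rcoact (F := fun (v : C) (h c1 : H) => G v ⊗ ((b * h) ⊗ c1)) c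
  (rcoact_axioms C)); try by lin.
apply: eq_tlift => v h.
by rewrite (hopf_cancel (F := fun h1 h2 x => G v ⊗ ((x * h1) ⊗ h2))); try lin.
Qed.

(** Rotating before coacting puts the H-component of c_0 last in the product, while coacting before
    rotating puts it first. Conjugation by S(h_3) and h_1, exactly as in condition (i), corrects
    this discrepancy. *)
Lemma rotate_diag_coact n (y : T n) :
  \tens_(v, h <- rotate y) \tens_(v0, v1 <- diag_coact v) v0 ⊗ (v1 ⊗ h) =
  \tens_(y0, y1 <- diag_coact y) \tens_(v, h <- rotate y0)
    \tens_(h1, h' <- hcomul H h) \tens_(h2, h3 <- hcomul H h')
      v ⊗ ((antipode H h3 * y1 * h1) ⊗ h2).
Proof.
case: n y => [|n] y.
  (* With a single factor there is no tail, so the H-component b of the tail is 1. *)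
  have := rcoact_twist (V := C) y 1 (@lin_id _ _).
  under eq_tlift => c0 c1 do under eq_tlift => v h do
    under eq_tlift => h1 h' do under eq_tlift => h2 h3 do rewrite mulr1.
  under [RHS]eq_tlift => c0 c1 do under eq_tlift => v h do rewrite mul1r.
  by move=> <-.
move: y; apply: tens_ext; [by lin..|move=> c y].
rewrite rotateSE diag_coactSE tlift_tlift; last by split; lin.
rewrite [RHS]tlift_tlift; last by split; lin.
(* The middle term is the right side of [rcoact_twist] with b = y_1 and G = [append y0]. *)
transitivity (\tens_(y0, y1 <- diag_coact y) \tens_(c0, c1 <- rcoact C c)
    \tens_(v, h <- rcoact C c0) append y0 v ⊗ ((y1 * h) ⊗ c1)).
  rewrite tlift_exchange; apply: eq_tlift => c0 c1.
  rewrite tliftE; last by split; lin.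
  rewrite diag_coact_append tlift_tlift; last by split; lin.
  apply: eq_tlift => y0 y1; rewrite tlift_tlift; last by split; lin.
  by apply: eq_tlift => v h; rewrite tliftE //; split; lin.
have Al (y0 : T n) : linear (append y0) by exact: (append_bilinear C n).2.
rewrite (eq_tlift _ (fun y0 y1 => esym (rcoact_twist c y1 (Al y0)))).
rewrite tlift_exchange; apply: eq_tlift => c0 c1.
rewrite tlift_tlift; last by split; lin.
apply: eq_tlift => y0 y1; rewrite tliftE; last by split; lin.
rewrite rotateSE tlift_tlift; last by split; lin.
by apply: eq_tlift => v h; rewrite tliftE //; split; lin.
Qed.
End TensorPowers.
Arguments rotate : simpl never.

(** * Functoriality of the cotensor product *)

Section CotensorMaps.
Context {k : fieldType} {H : hopfAlgebra k}.

(** The map f ⊗ id applied to the defining equation of the cotensor product yields the equation for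
    the image, because f is colinear. *)
Lemma cotensor_map (V W M : lmodType k) (r : {linear V -> V ⨂ H})
    (r' : {linear W -> W ⨂ H}) (l : {linear M -> H ⨂ M})
    (f : V -> W) (x : V ⨂ M) : linear f ->
  (forall v, r' (f v) = \tens_(v0, v1 <- r v) f v0 ⊗ v1) ->
  x \in cotensor_pred r l ->
  (\tens_(v, m <- x) f v ⊗ m) \in cotensor_pred r' l.
Proof.
move=> fl rf; rewrite !inE => /eqP E; apply/eqP.
pose L (t : V ⨂ (H ⨂ M)) := \tens_(v, u <- t) f v ⊗ u.
have bL : bilinear_for *:%R *:%R (fun v (u : H ⨂ M) => f v ⊗ u) by split; lin.
transitivity (L (\tens_(v, m <- x) \tens_(v0, v1 <- r v) v0 ⊗ (v1 ⊗ m))).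
  rewrite tlift_tlift; last by split; lin.
  rewrite /L tlift_tlift //; apply: eq_tlift => v m.
  rewrite tliftE; last by split; lin.
  rewrite rf !tlift_tlift //; last by split; lin.
  by apply: eq_tlift => v0 v1; rewrite !tliftE //; split; lin.
rewrite E tlift_tlift; last by split; lin.
rewrite /L tlift_tlift //; apply: eq_tlift => v m.
by rewrite !tliftE //; split; lin.
Qed.
End CotensorMaps.

(** * Cocyclic identities on the whole spaces C^(n+1) ⊗ M *)

Section Cochains.
Context {k : fieldType} {H : hopfAlgebra k} (C : comodCoalgebra H).
Variable M : modcomod H.
Implicit Types (n i j : nat) (c : C) (m : M).
Local Notation T := (tpow C).
Local Notation X n := (tpow C n ⨂ M)%type.

HB.instance Definition _ n i :=
  GRing.isLinear.Build k (X n) (X n.+1) _ (@coface k H C M n i)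
    (@coface_linear k H C M n i).
HB.instance Definition _ n i :=
  GRing.isLinear.Build k (X n.+1) (X n) _ (@codegen k H C M n i)
    (@codegen_linear k H C M n i).
HB.instance Definition _ n :=
  GRing.isLinear.Build k (X n) (X n) _ (@cyclic_op k H C M n)
    (@cyclic_op_linear k H C M n).

Arguments coface : simpl never.
Arguments codegen : simpl never.
Arguments cyclic_op : simpl never.

Lemma cyclic_op_tens n (y : T n) m :
  cyclic_op (y ⊗ m) = \tens_(v, h <- rotate y) v ⊗ act m h.
Proof.
case: n y => [|n] y; first by rewrite /cyclic_op tliftE //; split; lin.
rewrite /cyclic_op tliftE; last by split; lin.
move: y; apply: tens_ext; [by lin..|move=> c y].
rewrite rotateSE tliftE; last by split; lin.
rewrite tlift_tlift; last by split; lin.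
by apply: eq_tlift => c0 c1; rewrite tliftE //; split; lin.
Qed.

Lemma coface_tens n i (y : T n) m : (i <= n)%N ->
  coface i (y ⊗ m) = comul_at i y ⊗ m.
Proof. by move=> lein; rewrite /coface lein tliftE //; split; lin. Qed.

Lemma codegen_tens n i (y : T n.+1) m :
  codegen i (y ⊗ m) = counit_at i.+1 y ⊗ m.
Proof. by rewrite /codegen tliftE //; split; lin. Qed.

Lemma coface_last n (x : X n) : coface n.+1 x = cyclic_op (coface 0 x).
Proof.
rewrite {1}/coface ltnn; move: x; apply: tens_ext.
- by case: n => [|n]; lin.
- by apply: lin_comp; [exact: cyclic_op_linear | exact: coface_linear].
case: n => [|n] y m; rewrite coface_tens // cyclic_op_tens /last_coface.
  rewrite comul_at00E tliftE; last by split; lin.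
  rewrite [in RHS](tensE (comul C y)).
  rewrite (linear_tlift (L := @rotate _ _ C 1)); last by lin.
  rewrite tlift_tlift; last by split; lin.
  apply: eq_tlift => a b; rewrite rotateSE tlift_tlift; last by split; lin.
  by apply: eq_tlift => a0 a1; rewrite tliftE //; split; lin.
rewrite tliftE; last by split; lin.
move: y; apply: tens_ext; [by lin..|move=> c y].
rewrite comul_at0E tliftE; last by split; lin.
rewrite (linear_tlift (L := @rotate _ _ C n.+2)); last by lin.
rewrite tlift_tlift; last by split; lin.
apply: eq_tlift => a b; rewrite rotateSE tlift_tlift; last by split; lin.
by apply: eq_tlift => a0 a1; rewrite tliftE ?appendSE //; split; lin.
Qed.

Lemma cyclic_op_coface n i (x : X n) : (i <= n)%N ->
  cyclic_op (coface i.+1 x) = coface i (cyclic_op x).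
Proof.
move=> lein; move: x; apply: tens_ext.
- by apply: lin_comp; [exact: cyclic_op_linear | exact: coface_linear].
- by apply: lin_comp; [exact: coface_linear | exact: cyclic_op_linear].
move=> y m; move: lein; rewrite leq_eqVlt => /predU1P[->|ltin]; last first.
  rewrite coface_tens // !cyclic_op_tens rotate_comul_at //.
  rewrite tlift_tlift; last by split; lin.
  rewrite (linear_tlift (L := @coface _ _ _ _ _ _)); last exact: coface_linear.
  apply: eq_tlift => v h; rewrite tliftE ?coface_tens //; last by split; lin.
  exact: ltnW.
(* For i = n the claim reads τ τ δ_0 = δ_n τ. Rotating both halves of Δ(c_0) in turn agrees with
   rotating c_0 and then comultiplying it, by [rcoact_comul_act]. *)
rewrite coface_last coface_tens // !cyclic_op_tens.
rewrite (linear_tlift (L := @coface _ _ _ _ _ _)); last exact: coface_linear.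
rewrite (linear_tlift (L := @cyclic_op _ _ _ _ _)); last exact: cyclic_op_linear.
have Al p (z : T p) : linear (append z) by exact: (append_bilinear C p).2.
case: n y => [|n] y.
  rewrite comul_at00E rotate0E.
  transitivity (\tens_(c0, h <- rcoact C y) \tens_(a, b <- comul C c0)
       (a ⊗ b : T 1) ⊗ act m h); last first.
    apply: eq_tlift => c0 h; rewrite coface_tens // comul_at00E.
    rewrite [in RHS](tensE (comul C c0)).
    by rewrite (linear_tlift (L := fun u => u ⊗ _)) //; lin.
  rewrite (rcoact_comul_act (F := fun a b => a ⊗ b : T 1)); try by lin.
  rewrite [in LHS](tensE (comul C y)).
  rewrite (linear_tlift (L := @rotate _ _ C 1)); last by lin.
  rewrite tlift_tlift; last by split; lin.
  apply: eq_tlift => a b; rewrite rotateSE tlift_tlift; last by split; lin.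
  apply: eq_tlift => a0 a1; rewrite tliftE; last by split; lin.
  rewrite cyclic_op_tens append0E rotateSE tlift_tlift; last by split; lin.
  by apply: eq_tlift => b0 b1; rewrite tliftE ?append0E //; split; lin.
move: y; apply: tens_ext; [by lin..|move=> c y].
rewrite comul_at0E rotateSE (linear_tlift (L := @rotate _ _ C n.+2)); last by lin.
rewrite [RHS]tlift_tlift; last by split; lin.
rewrite [LHS]tlift_tlift; last by split; lin.
transitivity (\tens_(c0, h <- rcoact C c) \tens_(a, b <- comul C c0)
     append (append y a) b ⊗ act m h); last first.
  apply: eq_tlift => c0 h; rewrite tliftE; last by split; lin.
  rewrite coface_tens // comul_at_append_last.
  by rewrite (linear_tlift (L := fun u => u ⊗ _)) //; lin.
rewrite (rcoact_comul_act (F := fun a b => append (append y a) b)); try by lin.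
apply: eq_tlift => a b; rewrite rotateSE tlift_tlift; last by split; lin.
apply: eq_tlift => a0 a1; rewrite tliftE; last by split; lin.
rewrite cyclic_op_tens appendSE rotateSE tlift_tlift; last by split; lin.
by apply: eq_tlift => b0 b1; rewrite tliftE //; split; lin.
Qed.

Lemma cyclic_op_codegen n i (x : X n.+1) : (i < n)%N ->
  cyclic_op (codegen i.+1 x) = codegen i (cyclic_op x).
Proof.
move=> ltin; move: x; apply: tens_ext; [by lin..|move=> y m].
rewrite codegen_tens !cyclic_op_tens rotate_counit_at //.
rewrite tlift_tlift; last by split; lin.
rewrite (linear_tlift (L := @codegen _ _ _ _ _ _)); last by lin.
by apply: eq_tlift => v h; rewrite tliftE ?codegen_tens //; split; lin.
Qed.

(** The rotated c_0 ends in the position erased by σ_n, and ε((c_0)_0) (c_0)_1 = ε(c_0) 1 makes the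
    action on m trivial. *)
Lemma codegen_cyclic_op n (x : X n.+1) :
  codegen n (cyclic_op x) = \tens_(y, m <- x) counit_at 0 y ⊗ m.
Proof.
move: x; apply: tens_ext; [by lin..|move=> y m].
rewrite cyclic_op_tens tliftE; last by split; lin.
move: y; apply: tens_ext; [by lin..|move=> c y].
rewrite rotateSE tlift_tlift; last by split; lin.
rewrite (linear_tlift (L := @codegen _ _ _ _ _ _)); last by lin.
rewrite counit_at0E tensZl -[in RHS](act1 m).
rewrite -(sweedler_rcoact_counit (F := fun h => y ⊗ act m h)); last by lin.
apply: eq_tlift => v h; rewrite tliftE; last by split; lin.
by rewrite codegen_tens counit_at_append_last tensZl.
Qed.

(** σ_0 erases c_1, which is the leading factor after one rotation; the second τ followed by σ_n
    erases that leading factor. *)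
Lemma cyclic_op_codegen0 n (x : X n.+1) :
  cyclic_op (codegen 0 x) = codegen n (cyclic_op (cyclic_op x)).
Proof.
rewrite codegen_cyclic_op; move: x; apply: tens_ext; [by lin..|move=> y m].
rewrite codegen_tens !cyclic_op_tens rotate_counit_at //.
rewrite [RHS]tlift_tlift; last by split; lin.
rewrite [LHS]tlift_tlift; last by split; lin.
by apply: eq_tlift => v h; rewrite !tliftE //; split; lin.
Qed.

Lemma coface_coface_inner n i j (x : X n) : (i <= j <= n)%N ->
  coface j.+1 (coface i x) = coface i (coface j x).
Proof.
move=> /andP[leij lejn]; move: x; apply: tens_ext; [by lin..|move=> y m].
have lein := leq_trans leij lejn.
by rewrite !coface_tens ?comul_at_comul_at ?leij // ltnW.
Qed.

Lemma codegen_codegen_op n i j (x : X n.+2) : (i <= j <= n)%N ->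
  codegen j (codegen i x) = codegen i (codegen j.+1 x).
Proof.
move=> leij; move: x; apply: tens_ext; [by lin..|move=> y m].
by rewrite !codegen_tens counit_at_counit_at.
Qed.

Lemma codegen_coface_op_lt n i j (x : X n.+1) : (i <= j <= n)%N ->
  codegen j.+1 (coface i x) = coface i (codegen j x).
Proof.
move=> leij; have /andP[lei lej] := leij; have lein := leq_trans lei lej.
move: x; apply: tens_ext; [by lin..|move=> y m].
rewrite coface_tens; last exact: leqW.
by rewrite !codegen_tens coface_tens // counit_at_comul_at_lt.
Qed.

Lemma codegen_coface_op_r n j (x : X n) : (j <= n)%N ->
  codegen j (coface j x) = x.
Proof.
move=> lejn; move: x; apply: tens_ext; [by lin..|move=> y m].
by rewrite coface_tens // codegen_tens counit_at_comul_atr.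
Qed.

Lemma codegen_coface_op_l n j (x : X n) : (j <= n)%N ->
  codegen j (coface j.+1 x) = x.
Proof.
rewrite leq_eqVlt => /predU1P[->|ltjn]; last first.
  move: x; apply: tens_ext; [by lin..|move=> y m].
  by rewrite coface_tens // codegen_tens counit_at_comul_atl.
(* For j = n the coface is τ δ_0, and σ_n τ δ_0 is the counit on the first half of Δ(c_0). *)
rewrite coface_last codegen_cyclic_op; move: x.
apply: tens_ext; [by lin..|move=> y m].
rewrite coface_tens // tliftE; last by split; lin.
by rewrite counit_at_comul_atl.
Qed.

Lemma codegen_coface_op_gt n i j (x : X n.+1) : (j < i <= n.+1)%N ->
  codegen j (coface i.+1 x) = coface i (codegen j x).
Proof.
case/andP=> ltji; rewrite leq_eqVlt => /predU1P[ei|ltin]; last first.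
  move: x; apply: tens_ext; [by lin..|move=> y m].
  by rewrite coface_tens // !codegen_tens coface_tens // counit_at_comul_at_gt ?ltji.
(* For the last coface: σ_j τ δ_0 = τ σ_(j+1) δ_0 = τ δ_0 σ_j. *)
rewrite ei !coface_last -cyclic_op_codegen; last by rewrite -ei.
rewrite codegen_coface_op_lt //; rewrite ei ltnS in ltji; exact: ltji.
Qed.

Lemma coface_coface_op n i j (x : X n) : (i <= j <= n.+1)%N ->
  coface j.+1 (coface i x) = coface i (coface j x).
Proof.
case/andP=> leij; rewrite leq_eqVlt => /predU1P[ej|ltjn]; last first.
  by apply: coface_coface_inner; rewrite leij.
rewrite ej coface_last; move: leij; rewrite ej leq_eqVlt => /predU1P[->|ltin].
  (* For i = j = n+1 the two sides become τ τ δ_1 δ_0 and τ τ δ_0 δ_0. *)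
  rewrite !coface_last -(cyclic_op_coface (i := 0)) // -(cyclic_op_coface (i := n.+1)) //.
  by rewrite coface_last coface_coface_inner.
(* For i ≤ n: τ δ_0 δ_i = τ δ_(i+1) δ_0 = δ_i τ δ_0. *)
rewrite -(coface_coface_inner (i := 0)) // cyclic_op_coface; last exact: ltnW.
by rewrite coface_last.
Qed.
End Cochains.

(** * The power τ^(n+1) as the diagonal coaction followed by the action *)

Section CyclicOrder.
Context {k : fieldType} {H : hopfAlgebra k} (C : comodCoalgebra H).
Variable M : modcomod H.
Implicit Types (n : nat) (c : C) (m : M) (s t : seq C).
Local Notation T := (tpow C).
Local Notation TM n := (tpow C n ⨂ M)%type.

(* c_0 ⊗ ... ⊗ c_n, meaningful for sequences of size n.+1 *)
Fixpoint pure n s : T n :=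
  match n return T n with
  | 0 => head 0 s
  | n'.+1 => head 0 s ⊗ pure n' (behead s)
  end.

(** Iterated Sweedler sum: [F] receives the list of the (c_i)_0 and the ordered product of the
    (c_i)_1. Lists allow the factors to be cut at any position, which the nested tensor powers do
    not. *)
Fixpoint coact_seq (U : zmodType) s (F : seq C -> H -> U) : U :=
  if s is c :: s' then \tens_(c0, c1 <- rcoact C c)
    coact_seq s' (fun s0 h => F (c0 :: s0) (c1 * h))
  else F [::] 1.

Lemma eq_coact_seq (U : zmodType) s (F G : seq C -> H -> U) :
  (forall s0 h, size s0 = size s -> F s0 h = G s0 h) ->
  coact_seq s F = coact_seq s G.
Proof.
elim: s F G => [|c s IHs] F G FG /=; first exact: FG.
apply: eq_tlift => c0 c1; apply: IHs => s0 h szs.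
by apply: FG; rewrite /= szs.
Qed.

Lemma linear_coact_seq (U V : lmodType k) (L : U -> V) s (F : seq C -> H -> U) :
  linear L -> L (coact_seq s F) = coact_seq s (fun s0 h => L (F s0 h)).
Proof.
move=> Ll; elim: s F => [|c s IHs] F //=.
by rewrite (linear_tlift _ _ Ll); apply: eq_tlift => c0 c1; rewrite IHs.
Qed.

Lemma pure_ext n (U : lmodType k) (f g : T n -> U) :
  linear f -> linear g ->
  (forall s, size s = n.+1 -> f (pure n s) = g (pure n s)) -> f =1 g.
Proof.
elim: n f g => [|n IHn] f g fl gl fg; first by move=> c; exact: (fg [:: c]).
apply: tens_ext => // c; apply: IHn; [by lin..|move=> s szs].
by apply: (fg (c :: s)); rewrite /= szs.
Qed.

Lemma append_pure n s c :
  size s = n.+1 -> append (pure n s) c = pure n.+1 (rcons s c).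
Proof.
elim: n s => [|n IHn] [|a s] // [szs]; first by case: s szs.
by rewrite appendSE IHn.
Qed.

Lemma rotate_pure n c s : size s = n ->
  rotate (pure n (c :: s)) =
  \tens_(c0, c1 <- rcoact C c) pure n (rcons s c0) ⊗ c1.
Proof.
case: n s => [|n] s szs.
  by rewrite rotate0E [LHS]tensE; case: s szs.
by rewrite rotateSE; apply: eq_tlift => c0 c1; rewrite append_pure.
Qed.

Lemma diag_coact_pure n s : size s = n.+1 ->
  diag_coact (pure n s) = coact_seq s (fun s0 h => pure n s0 ⊗ h).
Proof.
elim: n s => [|n IHn] [|c s] // [szs] /=.
  case: s szs => //= _; rewrite diag_coact0E [LHS]tensE.
  by apply: eq_tlift => c0 c1; rewrite mulr1.
rewrite diag_coactSE; apply: eq_tlift => c0 c1; rewrite IHn //.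
rewrite (linear_coact_seq (L := fun t : T n ⨂ H =>
  \tens_(y0, y1 <- t) c0 ⊗ y0 ⊗ (c1 * y1))); last by lin.
by apply: eq_coact_seq => s0 h _; rewrite tliftE //; split; lin.
Qed.

Lemma iter_cyclic_op_linear n p : linear (iter p (@cyclic_op _ _ C M n)).
Proof.
elim: p => [|p IHp]; first exact: lin_id.
exact: (lin_comp (@cyclic_op_linear _ _ _ _ _) IHp).
Qed.

(** Generalised from the full list to a prefix [s], so that induction on [s] applies: each τ moves
    one coacted factor behind [t], and the successive actions compose to the product built by
    [coact_seq]. *)
Lemma iter_cyclic_op_pure n s t m : size (s ++ t) = n.+1 ->
  iter (size s) (@cyclic_op _ _ C M n) (pure n (s ++ t) ⊗ m) =
  coact_seq s (fun s0 h => pure n (t ++ s0) ⊗ act m h).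
Proof.
elim: s t m => [|c s IHs] t m /=; first by rewrite act1 cats0.
case=> szst; rewrite -iterS iterSr cyclic_op_tens rotate_pure //.
rewrite tlift_tlift; last by split; lin.
rewrite (linear_tlift _ _ (iter_cyclic_op_linear _)); apply: eq_tlift => c0 c1.
rewrite tliftE; last by split; lin.
rewrite rcons_cat IHs; last by rewrite -rcons_cat size_rcons szst.
by apply: eq_coact_seq => s0 h _; rewrite actM cat_rcons.
Qed.

Lemma iter_cyclic_op n (x : TM n) :
  iter n.+1 (@cyclic_op _ _ C M n) x =
  \tens_(y, m <- x) \tens_(y0, y1 <- diag_coact y) y0 ⊗ act m y1.
Proof.
move: x; apply: tens_ext; [exact: iter_cyclic_op_linear | by lin | move=> y m].
rewrite tliftE; last by split; lin.
move: y; apply: pure_ext; [|by lin|move=> s szs].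
  by apply: (lin_comp (iter_cyclic_op_linear _)); lin.
rewrite diag_coact_pure // -[in LHS]szs -[in LHS](cats0 s) size_cat addn0.
rewrite iter_cyclic_op_pure ?cats0 //.
rewrite (linear_coact_seq (L := fun t : T n ⨂ H =>
  \tens_(y0, y1 <- t) y0 ⊗ act m y1)); last by lin.
by apply: eq_coact_seq => s0 h _; rewrite tliftE //; split; lin.
Qed.
End CyclicOrder.

(** * Invariance of the cotensor product under the cyclic operator *)

Section Cotensor.
Context {k : fieldType} {H : hopfAlgebra k} (C : comodCoalgebra H).
Variable M : modcomod H.
Implicit Types (n i j : nat) (c : C) (m : M).
Local Notation T := (tpow C).
Local Notation TM n := (tpow C n ⨂ M)%type.

Hypothesis compat : forall (c : C) (m : M),
  \tens_(c0, c1 <- rcoact C c) c0 ⊗ lcoact M (act m c1)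
  = \tens_(c0, h <- rcoact C c)
      \tens_(h1, h' <- hcomul H h) \tens_(h2, h3 <- hcomul H h')
      \tens_(m1, m0 <- lcoact M m)
        c0 ⊗ ((antipode H h3 * m1 * h1) ⊗ act m0 h2).

Lemma rcoact_lcoact (V : lmodType k) (G : C -> V) c m : linear G ->
  \tens_(c0, c1 <- rcoact C c) G c0 ⊗ lcoact M (act m c1)
  = \tens_(c0, h <- rcoact C c)
      \tens_(h1, h' <- hcomul H h) \tens_(h2, h3 <- hcomul H h')
      \tens_(m1, m0 <- lcoact M m)
        G c0 ⊗ ((antipode H h3 * m1 * h1) ⊗ act m0 h2).
Proof.
move=> Gl.
pose L (t : C ⨂ (H ⨂ M)) := \tens_(c0, u <- t) G c0 ⊗ u.
have bL : bilinear_for *:%R *:%R (fun c0 (u : H ⨂ M) => G c0 ⊗ u) by split; lin.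
have := congr1 L (compat c m); rewrite /L !tlift_tlift //.
under eq_tlift => c0 c1 do rewrite tliftE //.
move=> ->; apply: eq_tlift => c0 h.
rewrite tlift_tlift //; apply: eq_tlift => h1 h'.
rewrite tlift_tlift //; apply: eq_tlift => h2 h3.
by rewrite tlift_tlift //; apply: eq_tlift => m1 m0; rewrite tliftE.
Qed.

(** Only the rotated factor c_0 acts on m, so condition (i) for c_0 is transported along the linear
    map [append y]. *)
Lemma rotate_lcoact n (y : T n) m :
  \tens_(v, h <- rotate y) v ⊗ lcoact M (act m h)
  = \tens_(v, h <- rotate y)
      \tens_(h1, h' <- hcomul H h) \tens_(h2, h3 <- hcomul H h')
      \tens_(m1, m0 <- lcoact M m)
        v ⊗ ((antipode H h3 * m1 * h1) ⊗ act m0 h2).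
Proof.
case: n y => [|n] y; first exact: (rcoact_lcoact _ _ (@lin_id _ _)).
move: y; apply: tens_ext; [by lin..|move=> c y].
rewrite rotateSE tlift_tlift; last by split; lin.
rewrite [RHS]tlift_tlift; last by split; lin.
have Al : linear (append y) by exact: (append_bilinear C n).2.
transitivity (\tens_(c0, c1 <- rcoact C c) append y c0 ⊗ lcoact M (act m c1)).
  by apply: eq_tlift => c0 c1; rewrite tliftE //; split; lin.
rewrite rcoact_lcoact //; apply: eq_tlift => c0 c1.
by rewrite tliftE //; split; lin.
Qed.

Lemma cyclic_op_cotensor n (x : TM n) :
  x \in cotensor_pred (@diag_coact _ _ C n) (lcoact M) ->
  cyclic_op x \in cotensor_pred (@diag_coact _ _ C n) (lcoact M).
Proof.
rewrite !inE => /eqP E; apply/eqP.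
(* Both sides of the cotensor condition for [cyclic_op x] are the images under
   the linear map [P] of the corresponding sides for [x]. *)
pose twist (y : T n) (g : H) (m : M) := \tens_(v, h <- rotate y)
  \tens_(h1, h' <- hcomul H h) \tens_(h2, h3 <- hcomul H h')
    v ⊗ ((antipode H h3 * g * h1) ⊗ act m h2).
pose P (t : T n ⨂ (H ⨂ M)) := \tens_(y, u <- t) \tens_(g, m <- u) twist y g m.
have bP : bilinear_for *:%R *:%R
    (fun y u => \tens_(g, m <- u) twist y g m) by rewrite /twist; split; lin.
have bt y : bilinear_for *:%R *:%R (twist y) by rewrite /twist; split; lin.
transitivity (P (\tens_(v, m <- x) \tens_(v0, v1 <- diag_coact v) v0 ⊗ (v1 ⊗ m))).
  clear E; move: x; rewrite /P; apply: tens_ext; [by lin..|move=> y m].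
  rewrite cyclic_op_tens tliftE; last by split; lin.
  rewrite tlift_tlift; last by split; lin.
  rewrite [RHS]tlift_tlift //.
  (* [Q] lets the second H-leg act on m, turning [rotate_diag_coact] into a statement about tensors
     with coefficients in M. *)
  pose Q (t : T n ⨂ (H ⨂ H)) := \tens_(v, u <- t) \tens_(g, h <- u)
    v ⊗ (g ⊗ act m h).
  have bQ : bilinear_for *:%R *:%R (fun v (u : H ⨂ H) => \tens_(g, h <- u)
    v ⊗ (g ⊗ act m h)) by split; lin.
  have bq v : bilinear_for *:%R *:%R (fun g h : H => v ⊗ (g ⊗ act m h)) by split; lin.
  have := congr1 Q (rotate_diag_coact y); rewrite /Q.
  rewrite [X in X = _ -> _]tlift_tlift // [X in _ = X -> _]tlift_tlift // => EQ.
  transitivity (\tens_(v, h <- rotate y)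
      \tens_(v1, u <- \tens_(v0, v1 <- diag_coact v) v0 ⊗ (v1 ⊗ h))
        \tens_(g, h0 <- u) v1 ⊗ (g ⊗ act m h0)).
    apply: eq_tlift => v h; rewrite tliftE; last by split; lin.
    rewrite [RHS]tlift_tlift //; apply: eq_tlift => v0 v1.
    by rewrite tliftE // tliftE.
  rewrite EQ; apply: eq_tlift => y0 y1; rewrite tliftE // tliftE // /twist.
  rewrite tlift_tlift //; apply: eq_tlift => v h.
  rewrite tlift_tlift //; apply: eq_tlift => h1 h'.
  rewrite tlift_tlift //; apply: eq_tlift => h2 h3.
  by rewrite tliftE // tliftE.
rewrite E; clear E; apply: esym; move: x; rewrite /P.
apply: tens_ext; [by lin..|move=> y m].
rewrite cyclic_op_tens [LHS]tlift_tlift; last by split; lin.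
(* On this side condition (i) computes the coaction of m h; what remains is to reorder finite
   sums. *)
transitivity (\tens_(v, h <- rotate y) v ⊗ lcoact M (act m h)).
  by apply: eq_tlift => v h; rewrite tliftE //; split; lin.
rewrite rotate_lcoact (tliftE (f := fun v m => v ⊗ lcoact M m)); last by split; lin.
rewrite tliftE // /twist [RHS]tlift_exchange; apply: eq_tlift => v h.
rewrite [RHS]tlift_exchange; apply: eq_tlift => h1 h'.
by rewrite [RHS]tlift_exchange.
Qed.
End Cotensor.

(** * Restriction of the operators and assembly of the cocyclic module *)

Lemma coface_cotensor (k : fieldType) (H : hopfAlgebra k) (C : comodCoalgebra H)
    (M : modcomod H) (n i : nat) (x : tpow C n ⨂ M) :
  (forall p (z : tpow C p ⨂ M),
     z \in cotensor_pred (@diag_coact _ _ C p) (lcoact M) ->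
     cyclic_op z \in cotensor_pred (@diag_coact _ _ C p) (lcoact M)) ->
  x \in cotensor_pred (@diag_coact _ _ C n) (lcoact M) ->
  coface i x \in cotensor_pred (@diag_coact _ _ C n.+1) (lcoact M).
Proof.
have inner j : (j <= n)%N ->
    x \in cotensor_pred (@diag_coact _ _ C n) (lcoact M) ->
    coface j x \in cotensor_pred (@diag_coact _ _ C n.+1) (lcoact M).
  move=> lejn; rewrite /coface lejn; apply: cotensor_map; first by lin.
  exact: diag_coact_comul_at.
move=> tau xP; have [lein|ltni] := leqP i n; first exact: inner.
(* Every index above n gives the last coface, so out-of-range indices also restrict and the family
   is total in i. *)
have -> : coface i x = coface n.+1 x by rewrite /coface ltnn leqNgt ltni.
by rewrite coface_last; apply/tau/inner.
Qed.

Lemma codegen_cotensor (k : fieldType) (H : hopfAlgebra k) (C : comodCoalgebra H)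
    (M : modcomod H) (n i : nat) (x : tpow C n.+1 ⨂ M) :
  x \in cotensor_pred (@diag_coact _ _ C n.+1) (lcoact M) ->
  codegen i x \in cotensor_pred (@diag_coact _ _ C n) (lcoact M).
Proof.
by apply: cotensor_map; [lin | exact: diag_coact_counit_at].
Qed.

(** Stated as a sigma type so that the restricted linear operators can be extracted as witnesses for
    [HCC]. *)
Lemma cotensor_lift (k : fieldType) (H : hopfAlgebra k) (V W M N : lmodType k)
    (r : {linear V -> V ⨂ H}) (l : {linear M -> H ⨂ M})
    (r' : {linear W -> W ⨂ H}) (l' : {linear N -> H ⨂ N})
    (f : {linear V ⨂ M -> W ⨂ N}) :
  (forall x, x \in cotensor_pred r l -> f x \in cotensor_pred r' l') ->
  {g : {linear cotensor r l -> cotensor r' l'} |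
    forall x, cotensor_val (g x) = f (cotensor_val x)}.
Proof.
move=> fP; pose g (x : cotensor r l) : cotensor r' l' := Cotensor (fP _ (cotensorP x)).
have gl : linear g by move=> a x y; apply: val_inj; rewrite /= linearP.
pose gL := GRing.isLinear.Build k _ _ _ g gl.
pose g' : {linear cotensor r l -> cotensor r' l'} := HB.pack g gL.
by exists g'.
Qed.

Theorem proposition1p18 (k : fieldType) (H : hopfAlgebra k)
    (M : modcomod H) (C : comodCoalgebra H) :
  SAYD C M -> HCC C M.
Proof.
case=> compat stable.
have tau n (x : tpow C n ⨂ M) :
    x \in cotensor_pred (@diag_coact _ _ C n) (lcoact M) ->
    cyclic_op x \in cotensor_pred (@diag_coact _ _ C n) (lcoact M).
  exact: cyclic_op_cotensor.
have dP n i := @cotensor_lift _ _ _ _ _ _ _ _ _ _ (@coface _ _ C M n i)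
  (fun x => @coface_cotensor _ _ C M n i x tau).
have sP n i := @cotensor_lift _ _ _ _ _ _ _ _ _ _ (@codegen _ _ C M n i)
  (@codegen_cotensor _ _ C M n i).
have tP n := @cotensor_lift _ _ _ _ _ _ _ _ _ _ (@cyclic_op _ _ C M n) (@tau n).
pose d n i : {linear cochains C M n -> cochains C M n.+1} := sval (dP n i).
pose s n i : {linear cochains C M n.+1 -> cochains C M n} := sval (sP n i).
pose t n : {linear cochains C M n -> cochains C M n} := sval (tP n).
have dE n i x : cotensor_val (d n i x) = coface i (cotensor_val x).
  exact: (svalP (dP n i)).
have sE n i x : cotensor_val (s n i x) = codegen i (cotensor_val x).
  exact: (svalP (sP n i)).
have tE n x : cotensor_val (t n x) = cyclic_op (cotensor_val x).
  exact: (svalP (tP n)).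
exists d, s, t; split=> [//|//|//|].
split=> [n i j x leij|n i j x leij|n i j x leij|n j x lejn|n i j x leij|n x|n i x lein
        |n x|n i x ltin|n x].
- by apply: val_inj; rewrite /= !dE coface_coface_op.
- by apply: val_inj; rewrite /= !sE codegen_codegen_op.
- by apply: val_inj; rewrite /= sE !dE sE codegen_coface_op_lt.
- by split; apply: val_inj;
    rewrite /= sE dE ?codegen_coface_op_r ?codegen_coface_op_l.
- by apply: val_inj; rewrite /= sE !dE sE codegen_coface_op_gt.
- by apply: val_inj; rewrite /= tE !dE coface_last.
- by apply: val_inj; rewrite /= tE !dE tE cyclic_op_coface.
- by apply: val_inj; rewrite /= tE !sE !tE cyclic_op_codegen0.
- by apply: val_inj; rewrite /= tE !sE tE cyclic_op_codegen.
(* Condition (ii) replaces x by y_0 ⊗ m y_1, which is τ^(n+1) on the ambient space; the iterates are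
   then compared by induction on their number. *)
- apply: val_inj; rewrite /= -[RHS](stable n x) -iter_cyclic_op -iterS.
  by elim: n.+1 => //= p IHp; rewrite tE IHp.
Qed.
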